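(* Let $T$ be a linear operator in $H$ with $\overline{\operatorname{dom}(T)}=H$. Let $H_n\subset\operatorname{dom}(T)$, $n\in\mathbb N$, be finite-dimensional subspaces with orthogonal projections $P_{H_n}\stackrel{s}{\to}I$. If $T_{H_n}\stackrel{gsr}{\to}T$, then (i) $W_e((T_{H_n})_{n\in\mathbb N})=W_e(T)$; (ii) $\sigma_{poll}((T_{H_n})_{n\in\mathbb N})\subset W_e(T)$; (iii) every isolated $\lambda\in\sigma(T)$ with $\lambda\notin W_e(T)$ is approximated by $(T_{H_n})_{n\in\mathbb N}$, i.e. there exist an infinite $I\subset\mathbb N$ and $\lambda_n\in\sigma(T_{H_n})$, $n\in I$, with $\lambda_n\to\lambda$.
   Context: $H$ is a separable infinite-dimensional complex Hilbert space. For $V\subset\operatorname{dom}(T)$ closed, $P_V$ is the orthogonal projection onto $V$ and $T_V:=P_VT|_V$ is the compression of $T$ to $V$. $W_e(T)=\{\lambda:\exists x_n\in\operatorname{dom}(T),\|x_n\|=1,x_n\stackrel{w}{\to}0,\langle Tx_n,x_n\rangle\to\lambda\}$. For operators $T_n$ in closed subspaces $H_n\subset H$ (orthogonal projections $P_n$): $T_n\stackrel{gsr}{\to}T$ means there exist $n_0$ and $\lambda_0\in\bigcap_{n\ge n_0}\rho(T_n)\cap\rho(T)$ with $(T_n-\lambda_0)^{-1}P_n\to(T-\lambda_0)^{-1}$ strongly; $W_e((T_n)_n)=\{\lambda:\exists I\subset\mathbb N\text{ infinite},\ x_n\in\operatorname{dom}(T_n)\ (n\in I),\ \|x_n\|=1,\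 x_n\stackrel{w}{\to}0,\ \langle T_nx_n,x_n\rangle\to\lambda\}$; $\sigma_{poll}((T_n)_n)=\{\lambda\notin\sigma(T):\exists I\subset\mathbb N\text{ infinite},\ \lambda_n\in\sigma(T_n),\ \lambda_n\to\lambda\}$. *)

(* Defs.v *)
(* complex numbers C := R[i] over an abstract R : realType,
   an abstract complex inner-product space, possibly unbounded operators
   given by a domain predicate and a function. *)
From HB Require Import structures.
From mathcomp Require Import all_boot all_order all_algebra.
From mathcomp Require Import complex.
From mathcomp Require Import reals.
Set Implicit Arguments. Unset Strict Implicit. Unset Printing Implicit Defensive.
Import Order.TTheory GRing.Theory Num.Theory.
Local Open Scope ring_scope.

Section Hilbert.
Variables (R : realType) (H : lmodType R[i]) (ip : H -> H -> R[i]).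

Definition vnorm (x : H) : R[i] := sqrtC (ip x x).

Definition inner_product_axioms : Prop :=
  [/\ forall (a : R[i]) x y z, ip (a *: x + y) z = a * ip x z + ip y z,
      forall x y, ip x y = Num.conj (ip y x),
      forall x, 0 <= ip x x
    & forall x, ip x x = 0 -> x = 0].

Definition cvg_to (x : nat -> H) (l : H) : Prop :=
  forall e : R[i], 0 < e -> exists N, forall n, (N <= n)%N -> vnorm (x n - l) < e.

Definition ccvg_along (I : nat -> Prop) (z : nat -> R[i]) (l : R[i]) : Prop :=
  forall e : R[i], 0 < e -> exists N, forall n, I n -> (N <= n)%N -> `|z n - l| < e.

Definition complete_space : Prop :=
  forall x : nat -> H,
    (forall e : R[i], 0 < e -> exists N, forall m n, (N <= m)%N -> (N <= n)%N ->
        vnorm (x m - x n) < e) ->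
    exists l, cvg_to x l.

Definition separable_space : Prop :=
  exists d : nat -> H, forall x (e : R[i]), 0 < e -> exists k, vnorm (x - d k) < e.

Definition infinite_dimensional : Prop :=
  forall n, exists v : 'I_n -> H, forall c : 'I_n -> R[i],
    \sum_(j < n) c j *: v j = 0 -> forall j, c j = 0.

Definition separable_inf_dim_hilbert : Prop :=
  [/\ inner_product_axioms, complete_space, separable_space & infinite_dimensional].

Definition linear_subspace (V : H -> Prop) : Prop :=
  V 0 /\ forall (a : R[i]) x y, V x -> V y -> V (a *: x + y).

Definition fin_dim_subspace (V : H -> Prop) : Prop :=
  exists n (v : 'I_n -> H), forall x, V x <-> exists c : 'I_n -> R[i], x = \sum_(j < n) c j *: v j.

Definition orth_proj (V : H -> Prop) (P : H -> H) : Prop :=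
  forall x, V (P x) /\ forall v, V v -> ip (x - P x) v = 0.

Definition linear_operator (D : H -> Prop) (T : H -> H) : Prop :=
  linear_subspace D /\ forall (a : R[i]) x y, D x -> D y -> T (a *: x + y) = a *: T x + T y.

Definition dense (D : H -> Prop) : Prop :=
  forall x (e : R[i]), 0 < e -> exists y, D y /\ vnorm (x - y) < e.

(* resolvent set of an operator A with domain D in the closed subspace V:
   A - lam : D -> V is bijective with bounded inverse *)
Definition resolvent (V D : H -> Prop) (A : H -> H) (lam : R[i]) : Prop :=
  (forall y, V y -> exists x, D x /\ A x - lam *: x = y /\
                   forall x', D x' -> A x' - lam *: x' = y -> x' = x)
  /\ exists M : R[i], forall x, D x -> vnorm x <= M * vnorm (A x - lam *: x).

Definition spectrum (V D : H -> Prop) (A : H -> H) (lam : R[i]) : Prop :=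
  ~ resolvent V D A lam.

(* compression T_V := P_V T |_V, an operator in V with domain V *)
Definition compression (P : H -> H) (T : H -> H) : H -> H := fun x => P (T x).

Definition infinite_nat (I : nat -> Prop) : Prop := forall N, exists n, (N <= n)%N /\ I n.

Definition weak_to0_along (I : nat -> Prop) (x : nat -> H) : Prop :=
  forall y, ccvg_along I (fun n => ip (x n) y) 0.

Definition ess_num_range (D : H -> Prop) (T : H -> H) (lam : R[i]) : Prop :=
  exists x : nat -> H, (forall n, D (x n) /\ vnorm (x n) = 1) /\
    weak_to0_along (fun _ => True) x /\
    ccvg_along (fun _ => True) (fun n => ip (T (x n)) (x n)) lam.

Definition ess_num_range_seq (D : nat -> H -> Prop) (T : nat -> H -> H) (lam : R[i]) : Prop :=
  exists (I : nat -> Prop) (x : nat -> H), infinite_nat I /\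
    (forall n, I n -> D n (x n) /\ vnorm (x n) = 1) /\
    weak_to0_along I x /\
    ccvg_along I (fun n => ip (T n (x n)) (x n)) lam.

Definition spectral_pollution (V D : nat -> H -> Prop) (Tn : nat -> H -> H)
    (DT : H -> Prop) (T : H -> H) (lam : R[i]) : Prop :=
  ~ spectrum (fun _ => True) DT T lam /\
  exists (I : nat -> Prop) (l : nat -> R[i]), infinite_nat I /\
    (forall n, I n -> spectrum (V n) (D n) (Tn n) (l n)) /\ ccvg_along I l lam.

(* generalized strong resolvent convergence T_n -> T,
   T_n an operator in V n (orthogonal projection P n) with domain D n *)
Definition gsr_convergence (V D : nat -> H -> Prop) (P : nat -> H -> H)
    (Tn : nat -> H -> H) (DT : H -> Prop) (T : H -> H) : Prop :=
  exists (n0 : nat) (lam0 : R[i]),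
    (forall n, (n0 <= n)%N -> resolvent (V n) (D n) (Tn n) lam0) /\
    resolvent (fun _ => True) DT T lam0 /\
    forall (y x : H) (xs : nat -> H),
      DT x -> T x - lam0 *: x = y ->
      (forall n, (n0 <= n)%N -> D n (xs n) /\ Tn n (xs n) - lam0 *: xs n = P n y) ->
      cvg_to xs x.

End Hilbert.

(* Main.v *)
(** [T] is approximated strongly on its graph by the compressions, so the defining
    vectors of [W_e(T)] can be moved into the subspaces [H_n]. If [w_n] in [H_n] are
    unit vectors with [(T_n - mu_n)^* w_n -> 0] and [mu_n -> mu] in [rho(T)], testing
    against approximations of [(T - mu)^-1 f] shows that [w_n] is weakly null, hence
    [mu] lies in [W_e(T)]; eigenvectors of [T_n^*] give (ii). For (iii), if no spectrum
    of [T_n] comes near [lam], the same argument and compactness bound [(T_n - mu)^-1]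
    uniformly on a small circle around [lam], the maximum principle extends the bound
    to [lam] itself, it passes to [T - lam] in the limit, and a Neumann series at a
    nearby point of [rho(T)] puts [lam] in [rho(T)]. *)
From HB Require Import structures.
From mathcomp Require Import all_boot all_order all_algebra.
From mathcomp Require Import cyclic separable cyclotomic complex.
From mathcomp Require Import reals boolp classical_sets topology normedtype sequences.
Import numFieldNormedType.Exports.
From mathcomp Require Import ring lra.
Require Import Defs.
Import Order.TTheory GRing.Theory Num.Theory.
Local Open Scope ring_scope.
Set Implicit Arguments. Unset Strict Implicit. Unset Printing Implicit Defensive.

(** The hypothesis [gsr_convergence] controls the graph of [T], not that of an adjoint. Smallness of
    [(T_n - mu)^* w] is therefore expressed by pairing [w] with the range of [T_n - mu]
    ([near_null]), and no adjoint of [T] ever appears. This is why (iii) needs isolatedness and a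
    detour: bounds are first obtained at a positive distance from [lam], inside [rho(T)], and only
    then carried to the centre. The transport takes place for fixed [n], where everything is a
    matrix, so the maximum principle can be proved algebraically, with finite means over roots of
    unity in place of contour integrals. Uniformity in [n] and [mu] comes from the finitary form of
    [W_e(T)]: its failure is witnessed by one finite set and one tolerance, so near-null vectors are
    excluded on a whole neighbourhood with a single [tau] and a single threshold for [n].
    Compactness then turns these local constants into global ones. *)

Lemma subrACA (V : zmodType) (a b c d : V) : a - b - (c - d) = a - c - (b - d).
Proof. by rewrite !opprD !opprK addrACA. Qed.

(** * Real-valued modulus on [R[i]] and decay of real sequences *)

Section Modulus.
Variable R : realType.
Local Open Scope complex_scope.
Implicit Types (z w : R[i]) (x e : R).

(** The norm of [R[i]] takes values in [R[i]], where the order is only partial. The real copy gives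
    access to a total order and to [lra] and [nra]. *)
Definition cmod z : R := complex.Re `|z|.

Lemma cmodE z : `|z| = (cmod z)%:C.
Proof. by rewrite /cmod RRe_real // normr_real. Qed.

Lemma cmod_ge0 z : 0 <= cmod z.
Proof. by rewrite -ler0c -cmodE. Qed.

Lemma cmodD z w : cmod (z + w) <= cmod z + cmod w.
Proof. by rewrite -lecR rmorphD /= -!cmodE ler_normD. Qed.

Lemma cmodM z w : cmod (z * w) = cmod z * cmod w.
Proof. by apply: complexI; rewrite rmorphM /= -!cmodE normrM. Qed.

Lemma cmodN z : cmod (- z) = cmod z.
Proof. by rewrite /cmod normrN. Qed.

Lemma cmodBC z w : cmod (z - w) = cmod (w - z).
Proof. by rewrite -cmodN opprB. Qed.

Lemma cmod_conj z : cmod (Num.conj z) = cmod z.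
Proof. by rewrite /cmod norm_conjC. Qed.

Lemma cmod0 : cmod 0 = 0.
Proof. by rewrite /cmod normr0. Qed.

Lemma cmod1 : cmod 1 = 1.
Proof. by rewrite /cmod normr1. Qed.

Lemma cmod_real x : 0 <= x -> cmod x%:C = x.
Proof.
by move=> x0; apply: complexI; rewrite -cmodE ger0_norm // ler0c.
Qed.

Lemma cmod_eq0 z : cmod z = 0 -> z = 0.
Proof. by move=> h; apply/eqP; rewrite -normr_eq0 cmodE h. Qed.

Lemma cmod_gt0 z : z != 0 -> 0 < cmod z.
Proof.
move=> z0; rewrite lt_neqAle cmod_ge0 andbT eq_sym.
by apply: contra_neq z0; exact: cmod_eq0.
Qed.

Lemma cmodX z n : cmod (z ^+ n) = cmod z ^+ n.
Proof. by apply: complexI; rewrite rmorphXn /= -!cmodE normrX. Qed.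

Lemma cmodV z : cmod z^-1 = (cmod z)^-1.
Proof. by apply: complexI; rewrite fmorphV /= -!cmodE normfV. Qed.

Lemma cmod_sum (I : finType) (F : I -> R[i]) :
  cmod (\sum_i F i) <= \sum_i cmod (F i).
Proof.
elim/big_ind2: _ => [|a b c d h1 h2|//]; first by rewrite cmod0.
by apply: le_trans (cmodD _ _) _; exact: lerD.
Qed.

Lemma cmod_sqr z : ((cmod z) ^+ 2)%:C = z * Num.conj z.
Proof. by rewrite rmorphXn /= -cmodE normCK. Qed.

Lemma complex_gt0E (e : R[i]) : 0 < e -> exists2 e' : R, 0 < e' & e = e'%:C.
Proof.
by case: e => a b; rewrite ltcE /= => /andP[/eqP -> a0]; exists a.
Qed.

Lemma ccvg_alongP (I : nat -> Prop) (z : nat -> R[i]) l :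
  ccvg_along I z l <-> forall e, 0 < e ->
    exists N, forall n, I n -> (N <= n)%N -> cmod (z n - l) < e.
Proof.
split=> h e.
  move=> e0; have [|N hN] := h e%:C; first by rewrite ltcR.
  by exists N => n In Nn; rewrite -ltcR -cmodE hN.
move=> /complex_gt0E[e' e0 ->]; have [N hN] := h _ e0.
by exists N => n In Nn; rewrite cmodE ltcR hN.
Qed.

Lemma cmod_le_ReIm z : cmod z <= `|complex.Re z| + `|complex.Im z|.
Proof.
rewrite {1}[z]complexE; apply: le_trans (cmodD _ _) _.
rewrite cmodM.
have ci : cmod 'i = 1.
  by apply: complexI; rewrite -cmodE normc_def /= expr0n expr1n add0r sqrtr1.
have cr a : cmod a%:C = `|a|.
  by rewrite /cmod normc_def /= expr0n addr0 sqrtr_sqr.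
by rewrite ci mul1r !cr.
Qed.

Lemma Re_le_cmod z : `|complex.Re z| <= cmod z.
Proof. by rewrite -lecR -cmodE normc_ge_Re. Qed.

Lemma Im_le_cmod z : `|complex.Im z| <= cmod z.
Proof.
by rewrite /cmod normc_def /= -sqrtr_sqr ler_wsqrtr // lerDr sqr_ge0.
Qed.

Lemma archi_inv e : 0 < e -> exists k : nat, k.+1%:R^-1 < e.
Proof.
move=> e0; have [k hk] : exists k : nat, e^-1 < k.+1%:R.
  exists (Num.truncn e^-1); apply: truncnS_gt.
by exists k; rewrite invf_plt ?posrE.
Qed.

Lemma exp_decay (q c e : R) : 0 <= q < 1 -> 0 < e ->
  exists N, forall n, (N <= n)%N -> q ^+ n * c < e.
Proof.
move=> /andP[q0 q1] e0.
have /cvgrPdist_lt/(_ (e / (`|c| + 1))) : (q ^+ n @[n --> \oo] --> (0 : R))%classic.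
  by apply: cvg_expr; rewrite ger0_norm.
have c1 : 0 < `|c| + 1 by rewrite ltr_wpDl.
case; first by rewrite divr_gt0.
move=> N _ hN; exists N => n /hN /=; rewrite sub0r normrN ger0_norm ?exprn_ge0 //.
rewrite ltr_pdivlMr // => h; apply: le_lt_trans h.
rewrite ler_wpM2l ?exprn_ge0 //.
by have := ler_norm c; lra.
Qed.

Lemma contraction_cvg0 (a d : nat -> R) (q : R) : 0 <= q < 1 ->
  (forall k, 0 <= a k) ->
  (forall k, a k.+1 <= q * a k + d k) ->
  (forall e, 0 < e -> exists N, forall k, (N <= k)%N -> d k < e) ->
  forall e, 0 < e -> exists N, forall k, (N <= k)%N -> a k < e.
Proof.
move=> /andP[q0 q1] a0 step hd e e0.
(* With this forcing term the recursion [t = q * t + e * (1 - q) / 2] has the fixed point [e / 2],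
   the constant in [bnd]. *)
have [|K hK] := hd (e * (1 - q) / 2); first by rewrite divr_gt0 ?mulr_gt0 ?subr_gt0.
have bnd m : a (K + m)%N <= q ^+ m * a K + e / 2.
  elim: m => [|m IH]; first by rewrite addn0 expr0; lra.
  rewrite addnS exprS; apply: le_trans (step _) _.
  have := hK (K + m)%N (leq_addr _ _).
  have : q * a (K + m)%N <= q * (q ^+ m * a K + e / 2) by rewrite ler_wpM2l.
  set u := q ^+ m * a K => h1 h2.
  rewrite -mulrA -/u; nra.
have [|//|N hN] := @exp_decay q (a K) (e / 2) _; first exact/andP.
  by rewrite divr_gt0.
exists (K + N)%N => k hk; have -> : k = (K + (k - K))%N.
  by rewrite subnKC // (leq_trans _ hk) // leq_addr.
have := hN (k - K)%N; have := bnd (k - K)%N.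
rewrite leq_subRL ?hk ?(leq_trans _ hk) ?leq_addr //.
move=> h /(_ isT); lra.
Qed.

End Modulus.

(** * Inner product, norm and Cauchy-Schwarz in real-valued form *)

Section InnerProduct.
Variables (R : realType) (H : lmodType R[i]) (ip : H -> H -> R[i]).
Hypothesis hip : inner_product_axioms ip.
Local Open Scope complex_scope.
Implicit Types (x y z : H) (a : R[i]) (e : R).

Lemma ip_linear a x y z : ip (a *: x + y) z = a * ip x z + ip y z.
Proof. by case: hip. Qed.

Lemma ip_conj x y : ip x y = Num.conj (ip y x).
Proof. by case: hip. Qed.

Lemma ipDl x y z : ip (x + y) z = ip x z + ip y z.
Proof. by rewrite -[x]scale1r ip_linear mul1r scale1r. Qed.

Lemma ip0l z : ip 0 z = 0.
Proof. by apply: (addrI (ip 0 z)); rewrite -ipDl !addr0. Qed.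

Lemma ipZl a x z : ip (a *: x) z = a * ip x z.
Proof. by rewrite -[a *: x]addr0 ip_linear ip0l addr0. Qed.

Lemma ipNl x z : ip (- x) z = - ip x z.
Proof. by rewrite -scaleN1r ipZl mulN1r. Qed.

Lemma ipBl x y z : ip (x - y) z = ip x z - ip y z.
Proof. by rewrite ipDl ipNl. Qed.

Lemma ipDr x y z : ip z (x + y) = ip z x + ip z y.
Proof. by rewrite ip_conj ipDl rmorphD /= -!ip_conj. Qed.

Lemma ipZr a x z : ip z (a *: x) = Num.conj a * ip z x.
Proof. by rewrite ip_conj ipZl rmorphM /= -ip_conj. Qed.

Lemma ip0r z : ip z 0 = 0.
Proof. by rewrite ip_conj ip0l rmorph0. Qed.

Lemma ipNr x z : ip z (- x) = - ip z x.
Proof. by rewrite ip_conj ipNl rmorphN /= -ip_conj. Qed.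

Lemma ipBr x y z : ip z (x - y) = ip z x - ip z y.
Proof. by rewrite ipDr ipNr. Qed.

Lemma ip_suml (I : finType) (F : I -> H) z :
  ip (\sum_i F i) z = \sum_i ip (F i) z.
Proof. by elim/big_ind2: _ => [|u a v b <- <-|//]; rewrite ?ip0l ?ipDl. Qed.

Lemma ip_sumr (I : finType) (F : I -> H) z :
  ip z (\sum_i F i) = \sum_i ip z (F i).
Proof. by elim/big_ind2: _ => [|u a v b <- <-|//]; rewrite ?ip0r ?ipDr. Qed.

Definition nrm x : R := complex.Re (vnorm ip x).

Lemma ip_ge0 x : 0 <= ip x x.
Proof. by case: hip. Qed.

Lemma vnormE x : vnorm ip x = (nrm x)%:C.
Proof. by rewrite /nrm RRe_real // ger0_real // /vnorm sqrtC_ge0 ip_ge0. Qed.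

Lemma nrm_ge0 x : 0 <= nrm x.
Proof. by rewrite -ler0c -vnormE /vnorm sqrtC_ge0 ip_ge0. Qed.

Lemma nrm_sqr x : (nrm x ^+ 2)%:C = ip x x.
Proof. by rewrite rmorphXn /= -vnormE /vnorm sqrtCK. Qed.

Lemma nrm_eq0 x : nrm x = 0 -> x = 0.
Proof.
by move=> h; case: hip => _ _ _; apply; rewrite -nrm_sqr h expr0n.
Qed.

Lemma nrm0 : nrm 0 = 0.
Proof.
by apply/eqP; rewrite -sqrf_eq0; apply/eqP/complexI; rewrite nrm_sqr ip0l.
Qed.

Lemma nrm_gt0 x : x != 0 -> 0 < nrm x.
Proof.
move=> x0; rewrite lt_neqAle nrm_ge0 andbT eq_sym.
by apply: contra_neq x0; exact: nrm_eq0.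
Qed.

Lemma nrmZ a x : nrm (a *: x) = cmod a * nrm x.
Proof.
apply/eqP; rewrite -(@eqrXn2 _ 2) ?mulr_ge0 ?nrm_ge0 ?cmod_ge0 //; apply/eqP.
apply: complexI; rewrite nrm_sqr exprMn rmorphM /= cmod_sqr nrm_sqr.
by rewrite ipZl ipZr mulrA.
Qed.

Lemma nrmN x : nrm (- x) = nrm x.
Proof. by rewrite -scaleN1r nrmZ cmodN cmod1 mul1r. Qed.

Lemma nrmBC x y : nrm (x - y) = nrm (y - x).
Proof. by rewrite -nrmN opprB. Qed.

Lemma cauchy_schwarz x y : cmod (ip x y) <= nrm x * nrm y.
Proof.
have [->|y0] := eqVneq y 0; first by rewrite ip0r cmod0 nrm0 mulr0.
have ny := nrm_gt0 y0.
have yy : ip y y != 0.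
  by rewrite -nrm_sqr -[0]/(0%:C) (inj_eq (@complexI _)) expf_neq0 // gt_eqF.
rewrite -(@ler_pXn2r _ 2) ?nnegrE ?mulr_ge0 ?nrm_ge0 ?cmod_ge0 //.
rewrite exprMn -ler_pdivrMr ?exprn_gt0 // -lecR -subr_ge0.
(* The gap in the inequality is the squared norm of the component of [x] orthogonal to [y]. *)
suff -> : (nrm x ^+ 2)%:C - (cmod (ip x y) ^+ 2 / nrm y ^+ 2)%:C =
    ip (x - (ip x y / ip y y) *: y) (x - (ip x y / ip y y) *: y) by exact: ip_ge0.
rewrite [X in _ - X]rmorphM fmorphV /= cmod_sqr !nrm_sqr.
rewrite ipBl !ipBr !ipZl !ipZr [in RHS](ip_conj y x).
rewrite !rmorphM fmorphV /= -(ip_conj y y).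
by field.
Qed.

Lemma cs_le {a b : R} {x y} : nrm x <= a -> nrm y <= b -> cmod (ip x y) <= a * b.
Proof.
move=> h1 h2; apply: le_trans (cauchy_schwarz _ _) _.
by apply: ler_pM; rewrite ?nrm_ge0.
Qed.

Lemma nrmD x y : nrm (x + y) <= nrm x + nrm y.
Proof.
rewrite -(@ler_pXn2r _ 2) ?nnegrE ?addr_ge0 ?nrm_ge0 //.
rewrite -lecR nrm_sqr ipDl !ipDr (ip_conj y x) -!nrm_sqr.
set t := ip x y.
have ht : t + Num.conj t = (complex.Re t *+ 2)%:C.
  by rewrite rmorphMn /= complexRe mulr2n -[LHS]mulr1 ReE; field.
have hc : complex.Re t <= cmod t.
  by rewrite -lecR -cmodE; apply: le_trans (normc_ge_Re t); rewrite lecR ler_norm.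
have := cauchy_schwarz x y; rewrite -/t => h.
rewrite addrA -[_ + t + _]addrA ht -!rmorphD lecR.
by rewrite mulr2n; nra.
Qed.

Lemma nrmB x y : nrm (x - y) <= nrm x + nrm y.
Proof. by apply: le_trans (nrmD _ _) _; rewrite nrmN. Qed.

Lemma nrm_tri x y z : nrm (x - z) <= nrm (x - y) + nrm (y - z).
Proof. by have := nrmD (x - y) (y - z); rewrite addrA subrK. Qed.

Lemma nrm_le_dist x y : nrm x <= nrm y + nrm (x - y).
Proof. by have := nrmD y (x - y); rewrite addrC subrK. Qed.

Lemma nrm_sum (I : finType) (F : I -> H) : nrm (\sum_i F i) <= \sum_i nrm (F i).
Proof.
elim/big_ind2: _ => [|a b c d h1 h2|//]; first by rewrite nrm0.
by apply: le_trans (nrmD _ _) _; exact: lerD.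
Qed.

Lemma nrm_normalize x : x != 0 -> nrm (((nrm x)^-1)%:C *: x) = 1.
Proof.
move=> x0; rewrite nrmZ cmod_real ?invr_ge0 ?nrm_ge0 //.
by rewrite mulVf // gt_eqF // nrm_gt0.
Qed.

Lemma cvg_toP (u : nat -> H) l : cvg_to ip u l <->
  forall e, 0 < e -> exists N, forall n, (N <= n)%N -> nrm (u n - l) < e.
Proof.
split=> h e.
  move=> e0; have [|N hN] := h e%:C; first by rewrite ltcR.
  by exists N => n Nn; rewrite -ltcR -vnormE hN.
move=> /complex_gt0E[e' e0 ->]; have [N hN] := h _ e0.
by exists N => n Nn; rewrite vnormE ltcR hN.
Qed.

Lemma vnorm_le (x y : H) (M : R) : nrm x <= M * nrm y -> vnorm ip x <= M%:C * vnorm ip y.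
Proof. by move=> h; rewrite !vnormE -rmorphM lecR. Qed.

Lemma vnorm1 x : vnorm ip x = 1 <-> nrm x = 1.
Proof. by rewrite vnormE; split => [[]//|->]. Qed.

End InnerProduct.

(** * Orthonormal bases, matrices of operators and duality in finite dimension *)

Section FiniteDimension.
Variables (R : realType) (H : lmodType R[i]) (ip : H -> H -> R[i]).
Hypothesis hip : inner_product_axioms ip.
Local Open Scope complex_scope.

Notation nrm := (nrm ip).

Definition span n (v : 'I_n -> H) (x : H) : Prop :=
  exists c : 'I_n -> R[i], x = \sum_(j < n) c j *: v j.

Lemma span_linear n (v : 'I_n -> H) (a : R[i]) x y :
  span v x -> span v y -> span v (a *: x + y).
Proof.
move=> [c ->] [d ->]; exists (fun j => a * c j + d j).
rewrite scaler_sumr -big_split; apply: eq_bigr => j _ /=.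
by rewrite scalerDl scalerA.
Qed.

Lemma span0 n (v : 'I_n -> H) : span v 0.
Proof. by exists (fun=> 0); rewrite big1 // => j _; rewrite scale0r. Qed.

Lemma span_gen n (v : 'I_n -> H) i : span v (v i).
Proof.
exists (fun j => (j == i)%:R); rewrite (bigD1 i) //= eqxx scale1r.
by rewrite big1 ?addr0 // => j /negbTE ->; rewrite scale0r.
Qed.

Lemma span_sub n (v : 'I_n -> H) m (e : 'I_m -> H) :
  (forall i, span e (v i)) -> forall x, span v x -> span e x.
Proof.
move=> h x [c ->]; elim/big_ind: _ => [|y z hy hz|j _]; first exact: span0.
  by rewrite -[y]scale1r; exact: span_linear.
by rewrite -[_ *: _]addr0; apply: span_linear => //; exact: span0.
Qed.

Definition orthonormal_family d (e : 'I_d -> H) : Prop :=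
  forall i j, ip (e i) (e j) = (i == j)%:R.

(** The family [v] may be dependent: a vector whose remainder [r] vanishes is dropped, so [d] can be
    smaller than [n]. *)
Lemma gram_schmidt n (v : 'I_n -> H) :
  exists d (e : 'I_d -> H), orthonormal_family e /\ forall x, span v x <-> span e x.
Proof.
elim: n v => [v|n IH v]; first by exists 0%N, v; split=> // -[].
have [d [e [on he]]] := IH (fun j => v (widen_ord (leqnSn n) j)).
have old i : span e (v (widen_ord (leqnSn n) i)).
  by apply/he; exact: (span_gen (fun j => v (widen_ord (leqnSn n) j))).
have old' i : span v (e i).
  have /he : span e (e i) by exact: span_gen.
  by apply: span_sub => j; exact: span_gen.
pose p := \sum_i ip (v ord_max) (e i) *: e i.
have pe : span e p by exists (fun i => ip (v ord_max) (e i)).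
pose r := v ord_max - p.
have re i : ip r (e i) = 0.
  rewrite (ipBl hip) (ip_suml hip) (bigD1 i) //= (ipZl hip) on eqxx mulr1.
  rewrite big1 ?addr0 ?subrr //.
  by move=> j /negbTE ji; rewrite (ipZl hip) on ji mulr0.
have max_r : v ord_max = 1 *: r + p by rewrite scale1r subrK.
have [r0|r0] := eqVneq r 0.
  exists d, e; split=> // x; split; apply: span_sub => i; last exact: old'.
  have [->|] := eqVneq i ord_max; first by rewrite max_r r0 scaler0 add0r.
  rewrite eq_sym => /unlift_some[j -> _].
  have -> : lift ord_max j = widen_ord (leqnSn n) j.
    by apply/val_inj; rewrite /= /bump leqNgt ltn_ord.
  exact: old.
pose w := ((nrm r)^-1)%:C *: r.
pose e' (i : 'I_d.+1) := if unlift ord_max i is Some j then e j else w.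
have e'l j : e' (lift ord_max j) = e j by rewrite /e' liftK.
have e'm : e' ord_max = w by rewrite /e' unlift_none.
have we j : ip w (e j) = 0 by rewrite (ipZl hip) re mulr0.
have ew j : ip (e j) w = 0 by rewrite (ip_conj hip) we rmorph0.
have ww : ip w w = 1 by rewrite -(nrm_sqr hip) (nrm_normalize hip) // expr1n.
have sub_e x : span e x -> span e' x.
  by apply: span_sub => i; rewrite -e'l; exact: span_gen.
exists d.+1, e'; split=> [i j|x].
  case: (unliftP ord_max i) => [i'|] ->; case: (unliftP ord_max j) => [j'|] ->.
  - by rewrite !e'l on (inj_eq lift_inj).
  - by rewrite e'l e'm ew eq_sym (negbTE (neq_lift _ _)).
  - by rewrite e'l e'm we (negbTE (neq_lift _ _)).
  - by rewrite e'm ww eqxx.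
split; apply: span_sub => i; case: (unliftP ord_max i) => [j|] ->.
- apply: sub_e; have -> : lift ord_max j = widen_ord (leqnSn n) j.
    by apply/val_inj; rewrite /= /bump leqNgt ltn_ord.
  exact: old.
- rewrite max_r; apply: span_linear; last exact: sub_e.
  have -> : r = (nrm r)%:C *: w + 0.
    by rewrite addr0 scalerA -rmorphM mulfV ?scale1r // gt_eqF // nrm_gt0.
  apply: span_linear; last exact: span0.
  by rewrite -e'm; exact: span_gen.
- by rewrite e'l.
- rewrite e'm -[w]addr0; apply: span_linear; last exact: span0.
  have -> : r = (-1) *: p + v ord_max by rewrite scaleN1r addrC.
  apply: span_linear; last exact: span_gen.
  by case: pe => c ->; apply: (span_sub old'); exists c.
Qed.

Definition onbasis (V : H -> Prop) d (e : 'I_d -> H) : Prop :=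
  orthonormal_family e /\ forall x, V x <-> span e x.

Lemma onbasis_exists V : fin_dim_subspace V -> exists d (e : 'I_d -> H), onbasis V e.
Proof.
move=> [n [v hv]]; have [d [e [on he]]] := gram_schmidt v.
exists d, e; split=> // x; split; first by move/hv/he.
by move/he/hv.
Qed.

(** Linearity is asked on [V] only, because a compression inherits it from [T], whose values outside
    its domain are arbitrary. *)
Definition linear_on (V : H -> Prop) (A : H -> H) : Prop :=
  (forall x, V x -> V (A x)) /\
  forall (a : R[i]) x y, V x -> V y -> A (a *: x + y) = a *: A x + A y.

Section Coordinates.
Variables (V : H -> Prop) (d : nat) (e : 'I_d -> H).
Hypothesis Ve : onbasis V e.

Definition vec (c : 'cV[R[i]]_d) : H := \sum_i c i 0 *: e i.
Definition coord (x : H) : 'cV[R[i]]_d := \col_i ip x (e i).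

Lemma V_linear (a : R[i]) x y : V x -> V y -> V (a *: x + y).
Proof. by case: Ve => _ h /h hx /h hy; apply/h; exact: span_linear. Qed.

Lemma V_0 : V 0.
Proof. by case: Ve => _ h; apply/h; exact: span0. Qed.

Lemma V_scale (a : R[i]) x : V x -> V (a *: x).
Proof. by move=> Vx; rewrite -[_ *: _]addr0; apply: V_linear => //; exact: V_0. Qed.

Lemma V_vec c : V (vec c).
Proof. by case: Ve => _ h; apply/h; exists (fun i => c i 0). Qed.

Lemma V_basis i : V (e i).
Proof. by case: Ve => _ h; apply/h; exact: span_gen. Qed.

Lemma vecK : cancel vec coord.
Proof.
case: Ve => on _ c; apply/matrixP => i j; rewrite mxE ord1 (ip_suml hip).
rewrite (bigD1 i) //= (ipZl hip) on eqxx mulr1 big1 ?addr0 // => k /negbTE ki.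
by rewrite (ipZl hip) on ki mulr0.
Qed.

Lemma coordK x : V x -> vec (coord x) = x.
Proof.
case: Ve => _ h /h[c hc]; have -> : x = vec (\col_i c i).
  by rewrite hc; apply: eq_bigr => i _; rewrite mxE.
by rewrite vecK.
Qed.

Lemma vec_linear (a : R[i]) b c : vec (a *: b + c) = a *: vec b + vec c.
Proof.
rewrite /vec scaler_sumr -big_split; apply: eq_bigr => i _ /=.
by rewrite !mxE scalerDl scalerA.
Qed.

Lemma vec0 : vec 0 = 0.
Proof. by rewrite /vec big1 // => i _; rewrite mxE scale0r. Qed.

Lemma vecZ (a : R[i]) b : vec (a *: b) = a *: vec b.
Proof. by rewrite -[a *: b]addr0 vec_linear vec0 addr0. Qed.

Lemma vecD b c : vec (b + c) = vec b + vec c.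
Proof. by rewrite -[b]scale1r vec_linear !scale1r. Qed.

Lemma vecB b c : vec (b - c) = vec b - vec c.
Proof. by rewrite -[in LHS]scaleN1r [in LHS]addrC vec_linear scaleN1r addrC. Qed.

Lemma vec_sum (I : finType) (F : I -> 'cV[R[i]]_d) :
  vec (\sum_i F i) = \sum_i vec (F i).
Proof. by elim/big_ind2: _ => [|u a v b <- <-|//]; rewrite ?vec0 ?vecD. Qed.

Lemma nrm_basis i : nrm (e i) = 1.
Proof.
case: Ve => on _; apply/eqP; rewrite -(@eqrXn2 _ 2) ?nrm_ge0 ?ler01 //.
by apply/eqP/complexI; rewrite (nrm_sqr hip) on eqxx expr1n.
Qed.

Lemma nrm_vec c : nrm (vec c) <= \sum_i cmod (c i 0).
Proof.
apply: le_trans (nrm_sum hip _) _; apply: ler_sum => i _.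
by rewrite (nrmZ hip) nrm_basis mulr1.
Qed.

Lemma coord_le x i : cmod (coord x i 0) <= nrm x.
Proof. by rewrite mxE -[nrm x]mulr1 -(nrm_basis i); exact: cauchy_schwarz. Qed.

Variable A : H -> H.
Hypothesis linA : linear_on V A.

Definition opmx : 'M[R[i]]_d := \matrix_(i, j) ip (A (e j)) (e i).

Lemma linear_on0 : A 0 = 0.
Proof.
case: linA => _ /(_ 1 0 0 V_0 V_0); rewrite !scale1r addr0 => h.
by apply: (addrI (A 0)); rewrite -h addr0.
Qed.

Lemma linear_on_vec c : A (vec c) = \sum_i c i 0 *: A (e i).
Proof.
(* Linearity of [A] holds on [V] only, so the induction over the sum has to carry membership
   along. *)
suff [] : V (vec c) /\ A (vec c) = \sum_i c i 0 *: A (e i) by [].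
apply: (big_ind2 (fun x y => V x /\ A x = y)).
- by split; [exact: V_0 | exact: linear_on0].
- case: linA => _ hl x _ y _ [Vx <-] [Vy <-]; rewrite -[x]scale1r hl //.
  by rewrite !scale1r; split=> //; rewrite -[x]scale1r; exact: V_linear.
- move=> i _; split; first by apply/V_scale/V_basis.
  case: linA => _ hl; rewrite -[_ *: e i]addr0 hl ?linear_on0 ?addr0 //.
    exact: V_basis.
  exact: V_0.
Qed.

Lemma opmxE c : A (vec c) = vec (opmx *m c).
Proof.
rewrite -[LHS]coordK; last by case: linA => + _; apply; exact: V_vec.
congr vec; apply/matrixP => i j; rewrite ord1 !mxE linear_on_vec (ip_suml hip).
by apply: eq_bigr => k _; rewrite (ipZl hip) !mxE mulrC.
Qed.

(** A singular matrix has a nonzero left null row [r]. Since [ip] is conjugate-linear on the right,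
    the conjugated entries of [r] are the coordinates of a vector orthogonal to the range, that is,
    of a kernel vector of the adjoint. *)
Lemma singular_annihilator : \det opmx = 0 ->
  exists w, [/\ V w, nrm w = 1 & forall v, V v -> ip (A v) w = 0].
Proof.
move/eqP/det0P => [r r0 hr].
pose c : 'cV[R[i]]_d := \col_i Num.conj (r 0 i).
have w0 : vec c != 0.
  apply: contra_neq r0 => h; apply/rowP => i; rewrite mxE.
  have /matrixP/(_ i 0) := vecK c; rewrite h !mxE (ip0l hip) => hi.
  by rewrite -[LHS]conjCK -hi rmorph0.
exists (((nrm (vec c))^-1)%:C *: vec c); split.
- exact/V_scale/V_vec.
- exact: nrm_normalize.
- move=> v Vv; rewrite (ipZr hip) -(coordK Vv) opmxE.
  set b := coord v.
  suff -> : ip (vec (opmx *m b)) (vec c) = (r *m (opmx *m b)) 0 0.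
    by rewrite mulmxA hr mul0mx mxE mulr0.
  rewrite /vec (ip_sumr hip) mxE; apply: eq_bigr => i _.
  by rewrite (ipZr hip) mxE conjCK -/(vec _) -[in RHS](vecK (opmx *m b)) [in RHS]mxE.
Qed.

Lemma regular_bound : \det opmx != 0 ->
  (forall y, V y -> exists x, V x /\ A x = y) /\
  exists2 M : R, 0 <= M & forall x, V x -> nrm x <= M * nrm (A x).
Proof.
move=> hdet; have U : opmx \in unitmx by rewrite unitmxE unitfE.
split=> [y Vy|].
  exists (vec (invmx opmx *m coord y)); split; first exact: V_vec.
  by rewrite opmxE mulmxA mulmxV // mul1mx coordK.
exists (\sum_i \sum_j cmod (invmx opmx i j)).
  by apply: sumr_ge0 => i _; apply: sumr_ge0 => j _; exact: cmod_ge0.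
move=> x Vx.
have hx : vec (invmx opmx *m coord (A x)) = x.
  by rewrite -{1}(coordK Vx) opmxE vecK mulmxA mulVmx // mul1mx coordK.
rewrite -{1}hx; apply: le_trans (nrm_vec _) _; rewrite mulr_suml.
apply: ler_sum => i _; rewrite mxE; apply: le_trans (cmod_sum _) _.
rewrite mulr_suml; apply: ler_sum => j _; rewrite cmodM ler_wpM2l ?cmod_ge0 //.
exact: coord_le.
Qed.

(* [w] is the normalized solution of [A^* w = u], obtained from Riesz in coordinates. *)
Lemma adjoint_small u delta :
  (forall y, V y -> exists x, V x /\ A x = y) ->
  (forall x y, V x -> V y -> A x = A y -> x = y) ->
  V u -> nrm (A u) < delta * nrm u ->
  exists w, [/\ V w, nrm w = 1 & forall v, V v -> cmod (ip (A v) w) <= delta * nrm v].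
Proof.
move=> surj inj Vu hu.
have [b hb] := choice (fun i => surj _ (V_basis i)).
have Vb i : V (b i) by case: (hb i).
pose c : 'cV[R[i]]_d := \col_i Num.conj (ip (b i) u).
have dual v : V v -> ip (A v) (vec c) = ip v u.
  move=> Vv; have VAv : V (A v) by case: linA => + _; exact.
  have comb : forall a : 'I_d -> R[i], V (\sum_i a i *: b i) /\
      A (\sum_i a i *: b i) = \sum_i a i *: e i.
    move=> a; apply: (big_ind2 (fun x y => V x /\ A x = y)).
    - by split; [exact: V_0 | exact: linear_on0].
    - case: linA => _ hl x _ y _ [Vx <-] [Vy <-]; rewrite -[x]scale1r hl //.
      by rewrite !scale1r; split=> //; rewrite -[x]scale1r; exact: V_linear.
    - move=> i _; split; first exact: V_scale.
      case: linA => _ hl; rewrite -[_ *: b i]addr0 hl ?linear_on0 ?addr0 //.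
        by case: (hb i) => _ ->.
      exact: V_0.
  have [Vs As] := comb (fun i => ip (A v) (e i)).
  have sv : \sum_i ip (A v) (e i) *: b i = v.
    apply: inj => //; rewrite As -[RHS](coordK VAv).
    by apply: eq_bigr => i _; rewrite mxE.
  rewrite -{2}sv (ip_sumr hip) (ip_suml hip); apply: eq_bigr => i _.
  by rewrite (ipZr hip) (ipZl hip) mxE conjCK mulrC.
have nu : 0 < nrm u.
  rewrite lt_neqAle nrm_ge0 // andbT eq_sym; apply/eqP => h.
  by move: hu; rewrite h mulr0 ltNge (nrm_ge0 hip).
(* Taking [v = u] in [dual] turns smallness of [A u] into a lower bound for the norm of [vec c].
   Normalizing then divides [ip v u] by a large number. *)
have key : nrm u ^+ 2 <= nrm (A u) * nrm (vec c).
  have := cauchy_schwarz hip (A u) (vec c); rewrite dual // -(nrm_sqr hip).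
  by rewrite cmod_real ?sqr_ge0.
have w0 : 0 < nrm (vec c).
  rewrite lt_neqAle nrm_ge0 // andbT eq_sym; apply/eqP => h.
  by move: key; rewrite h mulr0 leNgt exprn_gt0.
have big : nrm u <= delta * nrm (vec c).
  rewrite -(ler_pM2l nu) -expr2; apply: le_trans key _.
  by rewrite mulrCA mulrA ler_wpM2r ?(ltW w0) // ltW.
exists (((nrm (vec c))^-1)%:C *: vec c); split.
- exact/V_scale/V_vec.
- by apply: nrm_normalize => //; apply: contraTneq w0 => ->; rewrite (nrm0 hip) ltxx.
- move=> v Vv; rewrite (ipZr hip) dual // cmodM cmod_conj cmod_real; last by rewrite invr_ge0 ltW.
  rewrite ler_pdivrMl //; apply: le_trans (cauchy_schwarz hip _ _) _.
  by rewrite mulrC mulrA [_ * delta]mulrC ler_wpM2r ?nrm_ge0.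
Qed.

End Coordinates.
End FiniteDimension.

(** * A maximum principle for resolvents of matrices *)

Section MaximumPrinciple.
Variables (R : realType) (H : lmodType R[i]) (ip : H -> H -> R[i]).
Hypothesis hip : inner_product_axioms ip.
Local Open Scope complex_scope.
Notation nrm := (nrm ip).

Lemma primitive_root_exists n : (0 < n)%N ->
  exists z : R[i], n.-primitive_root z.
Proof.
pose p : {poly R[i]} := 'X^n - 1; have [r Dp] := closed_field_poly_normal p.
move=> n_gt0; rewrite (monicP _) ?monicXnsubC // scale1r in Dp.
have rn1: all n.-unity_root r by apply/allP=> z; rewrite -root_prod_XsubC -Dp.
have sz_r: (n < (size r).+1)%N.
  by rewrite -(size_prod_XsubC r id) -Dp size_XnsubC.
have [|z _] := hasP (has_prim_root n_gt0 rn1 _ sz_r); last by exists z.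
by rewrite -separable_prod_XsubC -Dp separable_Xn_sub_1 // pnatr_eq0 -lt0n.
Qed.

(** Geometric sum with ratio [z ^+ k]. It is the discrete counterpart of integrating a power over a
    circle: all nonconstant powers below [n] average to zero. *)
Lemma sum_prim_root_expr n (z : R[i]) k : n.-primitive_root z -> (k < n)%N ->
  \sum_(j < n) z ^+ (j * k) = if k == 0%N then n%:R else 0.
Proof.
move=> zP kn; case: eqP => [->|/eqP k0].
  by under eq_bigr do rewrite muln0 expr0; rewrite sumr_const card_ord.
have zk : z ^+ k != 1.
  rewrite -(prim_order_dvd zP); apply/negP => /dvdn_leq.
  by rewrite lt0n k0 leqNgt kn => /(_ isT).
under eq_bigr do rewrite mulnC exprM.
have : (z ^+ k - 1) * \sum_(j < n) (z ^+ k) ^+ j = 0.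
  by rewrite -subrX1 -exprM mulnC exprM (prim_expr_order zP) expr1n subrr.
by move/eqP; rewrite mulf_eq0 subr_eq0 (negbTE zk) /= => /eqP.
Qed.

Section Matrix.
Variables (d : nat) (e : 'I_d.+1 -> H).
Notation vec := (vec e).

(** A substitute for the spectral radius formula, by induction on the linear factors. The vector
    [c' = (N - b) c] is annihilated by the remaining factors, and [a ^+ k * nrm (vec (N ^+ k *m c))]
    satisfies a recursion with ratio [a * cmod b < 1] whose forcing term is the already decaying
    quantity for [c']. *)
Lemma annihilated_decay (N : 'M[R[i]]_d.+1) (a : R) (s : seq R[i]) : 0 <= a ->
  (forall b, b \in s -> a * cmod b < 1) ->
  forall c : 'cV_d.+1, horner_mx N (\prod_(b <- s) ('X - b%:P)) *m c = 0 ->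
  forall eta : R, 0 < eta -> exists K, forall k, (K <= k)%N ->
    a ^+ k * nrm (vec (N ^+ k *m c)) < eta.
Proof.
move=> a0; elim: s => [|b s IH] hs c.
  rewrite big_nil rmorph1 mul1mx => -> eta eta0; exists 0%N => k _.
  by rewrite mulmx0 vec0 (nrm0 hip) mulr0.
rewrite big_cons mulrC rmorphM /= -mulmxA rmorphB /= horner_mx_X horner_mx_C => hc.
have hs' b' : b' \in s -> a * cmod b' < 1.
  by move=> h; apply: hs; rewrite in_cons h orbT.
have {}IH := IH hs' _ hc.
set c' := _ *m c in IH.
apply: (@contraction_cvg0 _ _ (fun k => a * (a ^+ k * nrm (vec (N ^+ k *m c'))))
  (a * cmod b)).
- by rewrite mulr_ge0 ?cmod_ge0 //= hs ?mem_head.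
- by move=> k; rewrite mulr_ge0 ?exprn_ge0 ?nrm_ge0.
- move=> k.
  have -> : N ^+ k.+1 *m c = b *: (N ^+ k *m c) + N ^+ k *m c'.
    rewrite /c' mulmxBl mul_scalar_mx mulmxBr -scalemxAr addrC subrK.
    by rewrite exprSr mulmxA.
  rewrite vec_linear exprS.
  have := nrmD hip (b *: vec (N ^+ k *m c)) (vec (N ^+ k *m c')).
  rewrite (nrmZ hip) => h.
  apply: le_trans (_ : a * a ^+ k *
    (cmod b * nrm (vec (N ^+ k *m c)) + nrm (vec (N ^+ k *m c'))) <= _).
    by rewrite ler_wpM2l // mulr_ge0 // exprn_ge0.
  by rewrite le_eqVlt; apply/orP; left; apply/eqP; ring.
- move=> eta eta0; have a1 : 0 < a + 1 by rewrite ltr_wpDl.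
  have [|K hK] := IH (eta / (a + 1)); first by rewrite divr_gt0.
  exists K => k /hK h; apply: le_lt_trans (_ : a * (eta / (a + 1)) < _).
    by rewrite ler_wpM2l // ltW.
  by rewrite mulrA ltr_pdivrMr // mulrC ltr_pM2l // ltrDl.
Qed.

(** The sum is the Neumann series of [(M - mu)^-1 y] in powers of [N = M^-1], truncated after [m]
    terms; the residual telescopes. *)
Lemma resolvent_polynomial (M N : 'M[R[i]]_d.+1) (mu : R[i]) m (y : 'cV_d.+1) :
  M *m N = 1%:M ->
  M *m (\sum_(k < m) mu ^+ k *: (N ^+ k.+1 *m y))
    - mu *: (\sum_(k < m) mu ^+ k *: (N ^+ k.+1 *m y))
  = y - mu ^+ m *: (N ^+ m *m y).
Proof.
move=> MN; elim: m => [|m IH].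
  by rewrite !big_ord0 mulmx0 scaler0 subrr !expr0 scale1r mul1mx subrr.
rewrite big_ord_recr /= mulmxDr scalerDr opprD addrACA IH.
rewrite -scalemxAr [N ^+ m.+1 in X in _ + (X - _)]exprS -!mulmxA (mulmxA M N) MN mul1mx.
by rewrite addrA subrK scalerA -exprS.
Qed.

End Matrix.

(* The mean over the [m]-th roots of unity [w] of the polynomials
   [\sum_(k < m) (a w)^k A^-(k+1) y] is [A^-1 y], and [A - a w] maps each of them
   to [y - a^m A^-m y], whose second term vanishes as [m] grows. *)
Lemma resolvent_maximum_principle V A (eps a M0 : R) :
  fin_dim_subspace V -> linear_on V A -> 0 < a < eps -> 0 <= M0 ->
  (forall mu, cmod mu < eps -> resolvent ip V V A mu) ->
  (forall mu, cmod mu = a -> forall u, V u -> nrm u <= M0 * nrm (A u - mu *: u)) ->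
  forall u, V u -> nrm u <= M0 * nrm (A u).
Proof.
move=> fdV linA /andP[a0 aeps] M00 res bd u Vu.
(* Square matrices form a ring with powers and [horner_mx] in positive size only, so the zero
   subspace is settled apart. *)
have [[|d] [e Ve]] := onbasis_exists hip fdV.
  have -> : u = 0 by have [_ /(_ u)[/(_ Vu)[c ->] _]] := Ve; rewrite big_ord0.
  by rewrite (nrm0 hip) mulr_ge0 // nrm_ge0.
pose M := opmx ip e A.
have eps0 : 0 < eps := lt_trans a0 aeps.
(* An annihilator of the range of [A - mu] contradicts its surjectivity. *)
have nonsing mu : cmod mu < eps -> \det (M - mu%:M) != 0.
  move=> /res[surj _]; apply/eqP => h.
  pose Am x := A x - mu *: x.
  have linAm : linear_on V Am.
    case: linA => AV Al; split=> [x Vx|b x y Vx Vy].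
      by rewrite /Am addrC -scaleNr; apply: (V_linear Ve) => //; exact: AV.
    by rewrite /Am Al // scalerBr scalerDr !scalerA [mu * b]mulrC opprD addrACA.
  have opE : opmx ip e Am = M - mu%:M.
    apply/matrixP => i j; rewrite !mxE (ipBl hip) (ipZl hip).
    by case: Ve => on _; rewrite on eq_sym mulr_natr.
  have [|w [Vw w1 hw]] := singular_annihilator hip Ve linAm; first by rewrite opE.
  have [x [Vx [hx _]]] := surj w Vw.
  have := hw x Vx; rewrite /Am hx -(nrm_sqr hip) w1 expr1n => /eqP.
  by rewrite oner_eq0.
have MU : M \in unitmx.
  by have := nonsing 0; rewrite cmod0 raddf0 subr0 unitmxE unitfE; exact.
pose N := invmx M.
have MN : M *m N = 1%:M by rewrite mulmxV.
have [s hs] := closed_field_poly_normal (char_poly N).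
rewrite (monicP (char_poly_monic N)) scale1r in hs.
(* An eigenvalue [b] of [N] is nonzero and [b^-1] is an eigenvalue of [M], which by [nonsing] has
   modulus at least [eps > a]. *)
have small b : b \in s -> a * cmod b < 1.
  rewrite -root_prod_XsubC -hs -eigenvalue_root_char => /eigenvalueP[v hv v0].
  have vM : v = b *: (v *m M).
    by rewrite scalemxAl -hv -mulmxA /N mulVmx // mulmx1.
  have b0 : b != 0 by apply: contra_neq v0 => h; rewrite vM h scale0r.
  rewrite ltNge; apply/negP => ab.
  have cb := cmod_gt0 b0.
  have := nonsing b^-1; rewrite cmodV => /(_ _)/negP; apply.
    by apply: le_lt_trans aeps; rewrite -[leLHS]mul1r ler_pdivrMr.
  apply/det0P; exists v => //.
  by rewrite mulmxBr mul_mx_scalar {2}vM scalerA mulVf // scale1r subrr.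
set y := coord ip e (A u).
have uy : u = vec e (N *m y).
  rewrite /y -{2}(coordK hip Ve Vu) (opmxE hip Ve linA) (vecK hip Ve) mulmxA mulVmx //.
  by rewrite mul1mx (coordK hip Ve Vu).
have VAu : V (A u) by case: linA => + _; apply.
have hAu : vec e y = A u by exact: (coordK hip Ve VAu).
have decay := @annihilated_decay d e N a s (ltW a0) small y.
(* The product over [s] is the characteristic polynomial of [N], so it annihilates every vector and
   the decay holds for [y]. *)
rewrite -hs Cayley_Hamilton mul0mx in decay.
have mean m : (0 < m)%N ->
    nrm u <= M0 * (nrm (A u) + a ^+ m * nrm (vec e (N ^+ m *m y))).
  move=> m0; have [om omP] := primitive_root_exists m0.
  pose mu j := a%:C * om ^+ j.
  have om1 : cmod om = 1.
    apply/eqP; rewrite -(@pexpr_eq1 _ _ m) ?cmod_ge0 //.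
    by rewrite -cmodX (prim_expr_order omP) cmod1.
  have mu1 j : cmod (mu j) = a.
    by rewrite cmodM cmodX om1 expr1n mulr1 cmod_real // ltW.
  have mum j : mu j ^+ m = (a ^+ m)%:C.
    by rewrite exprMn -exprM mulnC exprM (prim_expr_order omP) expr1n mulr1 rmorphXn.
  pose z (j : nat) := \sum_(k < m) mu j ^+ k *: (N ^+ k.+1 *m y).
  have zle j : nrm (vec e (z j)) <= M0 * (nrm (A u) + a ^+ m * nrm (vec e (N ^+ m *m y))).
    apply: le_trans (bd _ (mu1 j) _ (V_vec Ve _)) _.
    rewrite ler_wpM2l // (opmxE hip Ve linA) -vecZ -vecB resolvent_polynomial // mum.
    rewrite vecB vecZ hAu; apply: le_trans (nrmB hip _ _) _.
    by rewrite (nrmZ hip) cmod_real // exprn_ge0 // ltW.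
  have zsum : \sum_(j < m) z j = m%:R *: (N *m y).
    rewrite exchange_big /=.
    transitivity (\sum_(k < m) (a%:C ^+ k * (if k == 0 :> nat then m%:R else 0))
      *: (N ^+ k.+1 *m y)).
      apply: eq_bigr => k _; rewrite -scaler_suml; congr (_ *: _).
      rewrite -(sum_prim_root_expr omP (ltn_ord k)) mulr_sumr.
      by apply: eq_bigr => j _; rewrite exprMn exprM.
    case: m m0 {omP mum z zle} => // m _; rewrite big_ord_recl /= expr0 mul1r expr1.
    by rewrite big1 ?addr0 // => k _; rewrite mulr0 scale0r.
  have m0' : 0 < m%:R :> R by rewrite ltr0n.
  rewrite -(ler_pM2l m0').
  have -> : m%:R * nrm u = nrm (\sum_(j < m) vec e (z j)).
    rewrite -vec_sum zsum vecZ -uy (nrmZ hip); congr (_ * _).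
    by rewrite -[in RHS](rmorph_nat (real_complex R)) cmod_real ?ler0n.
  apply: le_trans (nrm_sum hip _) _.
  apply: (@le_trans _ _ (\sum_(j < m) M0 * (nrm (A u) + a ^+ m * nrm (vec e (N ^+ m *m y))))).
    by apply: ler_sum => j _; exact: zle.
  by rewrite sumr_const card_ord mulr_natl.
(* [M0] may vanish, hence the tolerance [eta / (M0 + 1)] below. *)
have M1 : 0 < M0 + 1 by rewrite ltr_wpDl.
apply/ler_addgt0Pr => eta eta0.
have [|K hK] := decay erefl (eta / (M0 + 1)); first by rewrite divr_gt0.
apply: le_trans (mean K.+1 isT) _; rewrite mulrDr lerD2l.
apply: le_trans (_ : M0 * (eta / (M0 + 1)) <= _).
  by rewrite ler_wpM2l // ltW // hK.
by rewrite mulrA ler_pdivrMr // mulrC ler_pM2l // lerDl.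
Qed.

End MaximumPrinciple.

(** Compactness is applied to a square, a product of two segments; other closed regions are handled
    by making [Q] vacuous outside them. Monotonicity in [k] lets the local levels be merged through
    the filter at infinity. *)
Lemma square_uniform (R : realType) (a : R) (Q : nat -> R[i] -> Prop) :
  (forall k l mu, (k <= l)%N -> Q k mu -> Q l mu) ->
  (forall mu0, `|complex.Re mu0| <= a -> `|complex.Im mu0| <= a ->
     exists2 r : R, 0 < r & exists k, forall mu, cmod (mu - mu0) < r -> Q k mu) ->
  exists k, forall mu, `|complex.Re mu| <= a -> `|complex.Im mu| <= a -> Q k mu.
Proof.
move=> mono loc.
pose K : set (R * R) := (`[- a, a] `*` `[- a, a])%classic.
have cK : compact K by apply: compact_setX; exact: segment_compact.
move/compact_near_coveringP : cK => /(_ nat \oo%classic (fun k p => Q k (Complex p.1 p.2)) _).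
case=> [[x y] [/= hx hy]|k _ hk]; last first.
  exists k => -[x y] /= hx hy; apply: (hk k (leqnn k) (x, y)).
  by split; rewrite /= in_itv /= -ler_norml.
move: hx hy; rewrite /= !in_itv /= -!ler_norml => hx hy.
have [r r0 [k hk]] := loc (Complex x y) hx hy.
exists (ball (x, y) (r / 2), [set l | (k <= l)%N]%classic) => /=.
  by split; [apply: nbhsx_ballx; rewrite divr_gt0 | exists k].
move=> [[x' y'] l] /= [[/= bx by'] kl]; apply: mono kl _; apply: hk.
apply: le_lt_trans (cmod_le_ReIm _) _ => /=.
by move: bx by'; rewrite /ball /= distrC => bx; rewrite distrC => by'; lra.
Qed.

(** Level [k] is reached at some index [n >= k], with no control on which one; hence the conclusion
    along an infinite set [I]. *)
Lemma diagonal_extraction (X : Type) (G : nat -> nat -> X -> Prop) :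
  (forall k l n x, (k <= l)%N -> G l n x -> G k n x) ->
  (forall k, exists n x, (k <= n)%N /\ G k n x) ->
  exists (I : nat -> Prop) (x : nat -> X), infinite_nat I /\
    forall k, exists N, forall n, I n -> (N <= n)%N -> G k n (x n).
Proof.
move=> mono ex.
have [f hf] := choice ex; have [z hz] := choice hf.
(* Jumping to level [(f (lev k)).+1], together with [k <= f k], makes the indices [f (lev k)]
   strictly increasing, so no index serves two levels. *)
pose fix lev k := if k is k'.+1 then (f (lev k')).+1 else 0%N.
have fge k : (k <= f k)%N by case: (hz k).
have fz k : G k (f k) (z k) by case: (hz k).
have step k : (f (lev k) < f (lev k.+1))%N by rewrite /=; exact: fge.
have mon k l : (k < l)%N -> (f (lev k) < f (lev l))%N.
  by move=> kl; exact: (homo_ltn ltn_trans step kl).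
have levk k : (k <= lev k)%N.
  by elim: k => // k IH /=; rewrite ltnS; apply: leq_trans IH (fge _).
have mon' k l : (f (lev k) <= f (lev l))%N -> (k <= l)%N.
  by rewrite leqNgt [(k <= l)%N]leqNgt; apply: contra; exact: mon.
(* The sequence must be total: indices outside the range of [f \o lev] receive the arbitrary value
   [z 0]. *)
have pick n : exists x, forall k, f (lev k) = n -> G (lev k) n x.
  have [[k0 hk0]|no] := pselect (exists k, f (lev k) = n); last first.
    by exists (z 0%N) => k hk; case: no; exists k.
  exists (z (lev k0)) => k hk; have -> : k = k0.
    by apply/eqP; rewrite eqn_leq; apply/andP; split; apply: mon'; rewrite hk hk0.
  by rewrite -hk0; exact: fz.
have [x hx] := choice pick.
exists (fun n => exists k, f (lev k) = n), x; split.
  by move=> N; exists (f (lev N)); split; [exact: leq_trans (levk N) (fge _) | exists N].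
move=> k; exists (f (lev k)) => n [k' hk'] le_n.
apply: mono (hx n k' hk'); apply: leq_trans (levk k'); apply: mon'.
by rewrite hk'.
Qed.

(** * Finitary essential numerical range, and a Neumann argument for the resolvent set *)

Section EssentialNumericalRange.
Variables (R : realType) (H : lmodType R[i]) (ip : H -> H -> R[i]).
Hypothesis hip : inner_product_axioms ip.
Local Open Scope complex_scope.
Notation nrm := (nrm ip).
Implicit Types (D : H -> Prop) (T : H -> H) (lam mu : R[i]).

Definition approx_value D T (F : seq H) (eta : R) lam x : Prop :=
  [/\ D x, nrm x = 1, forall f, f \in F -> cmod (ip x f) < eta
    & cmod (ip (T x) x - lam) < eta].

(* Separability allows weak null sequences to be replaced by unit vectors almost
   orthogonal to a prescribed finite set, see [ess_num_range_finitary]. *)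
Definition finitary_ess D T lam : Prop :=
  forall F (eta : R), 0 < eta -> exists x, approx_value D T F eta lam x.

(** Failure is witnessed by a single pair [F], [eta]; halving [eta] absorbs a displacement of [lam]
    by less than [eta / 2]. *)
Lemma finitary_ess_open D T lam : ~ finitary_ess D T lam ->
  exists2 r : R, 0 < r & forall mu, cmod (mu - lam) < r -> ~ finitary_ess D T mu.
Proof.
move=> /existsNP[F /existsNP[eta /not_implyP[eta0 no]]].
exists (eta / 2); first by rewrite divr_gt0.
move=> mu hmu /(_ F (eta / 2))[|x [Dx x1 hF hx]]; first by rewrite divr_gt0.
apply: no; exists x; split=> // [f /hF h|]; first by lra.
have := cmodD (ip (T x) x - mu) (mu - lam); rewrite addrA subrK; lra.
Qed.

Lemma weak_to0_finite (I : nat -> Prop) (x : nat -> H) (F : seq H) (eta : R) :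
  weak_to0_along ip I x -> 0 < eta ->
  exists N, forall n, I n -> (N <= n)%N -> forall f, f \in F -> cmod (ip (x n) f) < eta.
Proof.
move=> wx eta0; elim: F => [|g F [N hN]]; first by exists 0%N.
have /ccvg_alongP/(_ eta eta0)[N' hN'] := wx g.
exists (maxn N N') => n In; rewrite geq_max => /andP[Nn N'n] f.
rewrite in_cons => /orP[/eqP ->|]; last exact: hN.
by have := hN' n In N'n; rewrite subr0.
Qed.

(** By Cauchy-Schwarz the unit norms make the pairing with [y] uniformly close to the pairing with a
    nearby [d j]. *)
Lemma weak_to0_dense (d : nat -> H) (I : nat -> Prop) (x : nat -> H) :
  (forall y (e : R[i]), 0 < e -> exists k, vnorm ip (y - d k) < e) ->
  (forall n, I n -> nrm (x n) = 1) ->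
  (forall k, exists N, forall n, I n -> (N <= n)%N ->
     forall j, (j <= k)%N -> cmod (ip (x n) (d j)) < k.+1%:R^-1) ->
  weak_to0_along ip I x.
Proof.
move=> hd x1 hx y; apply/ccvg_alongP => e e0.
have e2 : 0 < e / 2 by rewrite divr_gt0.
have [|j] := hd y (e / 2)%:C; first by rewrite ltcR.
rewrite (vnormE hip) ltcR => hj.
have [k hk] := archi_inv e2.
have [N hN] := hx (maxn j k); exists N => n In Nn; rewrite subr0.
have h1 := hN n In Nn j (leq_maxl _ _).
have h2 : (maxn j k).+1%:R^-1 <= k.+1%:R^-1 :> R.
  by rewrite lef_pV2 ?posrE ?ltr0n // ler_nat ltnS leq_maxr.
have := cauchy_schwarz hip (x n) (y - d j); rewrite x1 // mul1r => h3.
have := cmodD (ip (x n) (d j)) (ip (x n) (y - d j)).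
rewrite -(ipDr hip) [d j + _]addrC subrK.
by have := lt_trans (lt_le_trans h1 h2) hk; lra.
Qed.

Lemma ess_num_range_finitary D T lam : separable_space ip ->
  ess_num_range ip D T lam <-> finitary_ess D T lam.
Proof.
move=> [d hd]; split=> [[x [hx [wx /ccvg_alongP lx]]] F eta eta0|h].
  have [N hN] := weak_to0_finite F wx eta0; have [N' hN'] := lx _ eta0.
  have [Dx x1] := hx (maxn N N'); exists (x (maxn N N')); split=> //.
  - exact/(vnorm1 hip).
  - by apply: hN => //; exact: leq_maxl.
  - by apply: hN' => //; exact: leq_maxr.
have pos k : 0 < k.+1%:R^-1 :> R by rewrite invr_gt0 ltr0n.
have [x hx] := choice (fun k => h [seq d j | j <- iota 0 k.+1] _ (pos k)).
exists x; split; last split.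
- by move=> n; have [Dx x1 _ _] := hx n; split=> //; exact/(vnorm1 hip).
- apply: (weak_to0_dense hd) => [n _|k]; first by case: (hx n).
  exists k => n _ kn j jk; have [_ _ + _] := hx n.
  move=> /(_ (d j)) h1; apply: lt_le_trans (h1 _) _.
    by apply/mapP; exists j => //; rewrite mem_iota /= add0n ltnS (leq_trans jk).
  by rewrite lef_pV2 ?posrE ?ltr0n // ler_nat ltnS.
- apply/ccvg_alongP => e e0; have [k hk] := archi_inv e0.
  exists k => n _ kn; have [_ _ _ h1] := hx n; apply: lt_le_trans h1 _.
  apply: le_trans (ltW hk); by rewrite lef_pV2 ?posrE ?ltr0n // ler_nat ltnS.
Qed.

(** The bound at [lam] is transferred to [mu] with constant [2 * M0], independently of how [mu] was
    found. Then [x] solves [(T - lam) x = y] when it is fixed by [S (y + (lam - mu) *: x)] with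
    [S = (T - mu)^-1], a contraction with factor [2 * M0 * (1 / (4 * M0)) = 1 / 2]. *)
Lemma resolvent_neumann D T lam mu (M0 : R) :
  complete_space ip -> linear_operator D T -> resolvent ip (fun=> True) D T mu ->
  0 < M0 -> (forall x, D x -> nrm x <= M0 * nrm (T x - lam *: x)) ->
  M0 * cmod (mu - lam) <= 4^-1 -> resolvent ip (fun=> True) D T lam.
Proof.
move=> comp [[D0 DL] TL] [surj _] M0p low near.
have DB x y : D x -> D y -> D (x - y).
  by move=> Dx Dy; rewrite addrC -scaleN1r; exact: DL.
have TB x y : D x -> D y -> T (x - y) = T x - T y.
  by move=> Dx Dy; rewrite addrC -scaleN1r TL // scaleN1r addrC.
have low_mu x : D x -> nrm x <= 2 * M0 * nrm (T x - mu *: x).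
  (* Absorbing [4^-1 * nrm x] on the left gives the factor [4 / 3], rounded up to 2. *)
  move=> Dx; apply: le_trans (_ : 4 / 3 * M0 * nrm (T x - mu *: x) <= _); last first.
    by rewrite ler_wpM2r ?nrm_ge0 // ler_wpM2r ?ltW //; lra.
  have := low x Dx; have := nrmD hip (T x - mu *: x) ((mu - lam) *: x).
  rewrite (nrmZ hip) scalerBl addrA subrK => h1 h2.
  have : M0 * nrm (T x - lam *: x) <= M0 * nrm (T x - mu *: x) + 4^-1 * nrm x.
    apply: le_trans (_ : M0 * (nrm (T x - mu *: x) + cmod (mu - lam) * nrm x) <= _).
      by rewrite ler_wpM2l // ltW.
    by rewrite mulrDr lerD2l mulrA ler_wpM2r ?nrm_ge0.
  by rewrite -mulrA; lra.
have [S hS] := choice (fun y => surj y I).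
have DS y : D (S y) by case: (hS y).
have TS y : T (S y) - mu *: S y = y by case: (hS y) => _ [].
have lipS y y' : nrm (S y - S y') <= 2 * M0 * nrm (y - y').
  apply: le_trans (low_mu _ (DB _ _ (DS y) (DS y'))) _.
  by rewrite TB // scalerBr subrACA !TS.
split=> [y _|]; last first.
  by exists M0%:C => x Dx; apply: vnorm_le => //; exact: low.
pose Phi x := S (y + (lam - mu) *: x).
have lipPhi x x' : nrm (Phi x - Phi x') <= 2^-1 * nrm (x - x').
  apply: le_trans (lipS _ _) _.
  rewrite opprD addrACA subrr add0r -scalerBr (nrmZ hip) cmodBC -mulrA [M0 * _]mulrA.
  have := nrm_ge0 hip (x - x'); have := ler_wpM2r (nrm_ge0 hip (x - x')) near; lra.
pose xs k := iter k Phi 0.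
have bound k : nrm (xs k) <= 2 * nrm (Phi 0).
  elim: k => [|k IH]; first by rewrite /= nrm0 // mulr_ge0 // nrm_ge0.
  have := nrm_le_dist hip (Phi (xs k)) (Phi 0); have := lipPhi (xs k) 0.
  by rewrite subr0 /=; lra.
have cauchy k j : nrm (xs (k + j)%N - xs k) <= 2^-1 ^+ k * (2 * nrm (Phi 0)).
  elim: k => [|k IH]; first by rewrite add0n subr0 expr0 mul1r.
  rewrite exprS -mulrA; apply: le_trans (lipPhi _ _) _.
  by rewrite ler_wpM2l // invr_ge0.
have half : 0 <= (2^-1 : R) < 1 by rewrite invr_ge0 ler0n /=; lra.
have [l /(cvg_toP hip) hl] : exists l, cvg_to ip xs l.
  apply: comp => e /complex_gt0E[e' e0 ->].
  have [N hN] := exp_decay (2 * nrm (Phi 0)) half (divr_gt0 e0 (ltr0n _ 2)).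
  exists N => m n Nm Nn; rewrite (vnormE hip) ltcR.
  have h := hN N (leqnn N).
  have := cauchy N (m - N)%N; have := cauchy N (n - N)%N; rewrite !subnKC // => h1 h2.
  have := nrm_tri hip (xs m) (xs N) (xs n); rewrite (nrmBC hip (xs N)); lra.
have fixl : Phi l = l.
  apply/eqP; rewrite -subr_eq0; apply/eqP/(nrm_eq0 hip)/eqP.
  rewrite eq_le nrm_ge0 // andbT; apply/ler_addgt0Pr => e e0; rewrite add0r.
  have [|N hN] := hl (e / 2); first by rewrite divr_gt0.
  have h1 := hN N (leqnn N); have h2 := hN N.+1 (leqnSn N).
  have := nrm_tri hip (Phi l) (Phi (xs N)) l; have := lipPhi l (xs N).
  by rewrite (nrmBC hip l) /= in h2 *; lra.
(* The limit of the iterates lies in the domain because it is a value of [S]. *)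
have Dl : D l by rewrite -fixl; exact: DS.
exists l.
have Tl : T l - lam *: l = y.
  have := TS (y + (lam - mu) *: l); rewrite -/(Phi l) fixl scalerBl => /eqP.
  by rewrite subr_eq addrA subrK => /eqP ->; rewrite addrK.
split=> //; split=> // x' Dx' hx'.
apply/eqP; rewrite -subr_eq0; apply/eqP/(nrm_eq0 hip)/eqP.
rewrite eq_le nrm_ge0 // andbT; apply: le_trans (low _ (DB _ _ Dx' Dl)) _.
by rewrite TB // scalerBr subrACA Tl hx' subrr nrm0 // mulr0.
Qed.

End EssentialNumericalRange.

(** * Compressions to the subspaces [Hn n] and the three assertions *)

Section Galerkin.
Variables (R : realType) (H : lmodType R[i]) (ip : H -> H -> R[i]).
Hypothesis hip : inner_product_axioms ip.
Local Open Scope complex_scope.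
Notation nrm := (nrm ip).
Variables (D : H -> Prop) (T : H -> H).
Hypothesis hT : linear_operator D T.
Variables (Hn : nat -> H -> Prop) (P : nat -> H -> H).
Hypothesis hHn : forall n, fin_dim_subspace (Hn n).
Hypothesis hHnD : forall n x, Hn n x -> D x.
Hypothesis hP : forall n, orth_proj ip (Hn n) (P n).
Hypothesis hPs : forall x, cvg_to ip (fun n => P n x) x.
Let Tn n := compression (P n) T.
Hypothesis hgsr : gsr_convergence ip Hn Hn P Tn D T.
Let rho := resolvent ip (fun=> True) D T.

Lemma Hn_linear n (a : R[i]) x y : Hn n x -> Hn n y -> Hn n (a *: x + y).
Proof. by have [d [e Ve]] := onbasis_exists hip (hHn n); exact: (V_linear Ve). Qed.

Lemma ip_compression n v w : Hn n w -> ip (Tn n v) w = ip (T v) w.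
Proof.
move=> Hw; have [_ /(_ w Hw)] := hP n (T v).
by rewrite (ipBl hip) => /eqP; rewrite subr_eq0 => /eqP ->.
Qed.

(** [orth_proj] does not state that [P n] is linear. The linearity defect of [Tn n] lies in [Hn n],
    where pairings with [Tn n] and [T] agree; paired with itself it vanishes. *)
Lemma shifted_compression_linear n (mu : R[i]) :
  linear_on (Hn n) (fun v => Tn n v - mu *: v).
Proof.
have HT v : Hn n (Tn n v) by case: (hP n (T v)).
split=> [x Hx|a x y Hx Hy].
  by rewrite addrC -scaleNr; exact: Hn_linear.
suff -> : Tn n (a *: x + y) = a *: Tn n x + Tn n y.
  by rewrite scalerBr scalerDr !scalerA [mu * a]mulrC opprD addrACA.
set r := a *: Tn n x + Tn n y.
have Hr : Hn n r by exact: Hn_linear.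
have [DD TL] := hT.
have Hd : Hn n (Tn n (a *: x + y) - r).
  by rewrite addrC -scaleN1r; exact: Hn_linear.
apply/eqP; rewrite -subr_eq0; apply/eqP.
case: hip => _ _ _; apply.
rewrite {1}/r (ipBl hip) (ip_linear hip) !(ip_compression _ Hd).
rewrite TL; [|exact: hHnD Hx|exact: hHnD Hy].
by rewrite (ip_linear hip) subrr.
Qed.

(** Take [z = (Tn - lam0)^-1 P_n y] with [y = (T - lam0) x]. Resolvent convergence gives [z -> x],
    and then [Tn z = P_n y + lam0 z] tends to [y + lam0 x = T x]. *)
Lemma gsr_approx x (eta : R) : D x -> 0 < eta -> exists N, forall n, (N <= n)%N ->
  exists z, [/\ Hn n z, nrm (z - x) < eta & nrm (Tn n z - T x) < eta].
Proof.
move=> Dx eta0; have [n0 [lam0 [res [_ conv]]]] := hgsr.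
pose y := T x - lam0 *: x.
have [xs hxs] : exists xs : nat -> H, forall n, (n0 <= n)%N ->
    Hn n (xs n) /\ Tn n (xs n) - lam0 *: xs n = P n y.
  suff /choice[xs hxs] : forall n, exists z,
      (n0 <= n)%N -> Hn n z /\ Tn n z - lam0 *: z = P n y.
    by exists xs.
  move=> n; have [le|] := boolP (n0 <= n)%N; last by exists 0.
  have [surj _] := res n le; have [Py _] := hP n y.
  by have [z [Hz [hz _]]] := surj _ Py; exists z.
have /(cvg_toP hip) xsx := conv y x xs Dx erefl hxs.
(* This denominator makes both [nrm (z - x)] and [cmod lam0 * nrm (z - x)] smaller than [eta / 2];
   the other half is spent on [P n y - y]. *)
have c0 : 0 < 2 * (1 + cmod lam0) by rewrite mulr_gt0 // ltr_wpDr ?cmod_ge0.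
have [|N1 hN1] := xsx (eta / (2 * (1 + cmod lam0))); first by rewrite divr_gt0.
have /(cvg_toP hip)/(_ (eta / 2)) := hPs y.
case; first by rewrite divr_gt0.
move=> N2 hN2; exists (maxn n0 (maxn N1 N2)) => n; rewrite !geq_max => /and3P[n0n N1n N2n].
have [Hx hx] := hxs n n0n; exists (xs n).
have := hN1 n N1n; rewrite ltr_pdivlMr // => h1; have h2 := hN2 n N2n.
have h3 : cmod lam0 * nrm (xs n - x) >= 0 by rewrite mulr_ge0 ?cmod_ge0 ?nrm_ge0.
have h4 := nrm_ge0 hip (xs n - x).
split=> //; first by nra.
have -> : Tn n (xs n) - T x = (P n y - y) + lam0 *: (xs n - x).
  by rewrite -hx /y scalerBr subrACA subrK.
have := nrmD hip (P n y - y) (lam0 *: (xs n - x)); rewrite (nrmZ hip).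
by nra.
Qed.

Lemma gsr_approx_unit x (eta : R) : D x -> nrm x = 1 -> 0 < eta ->
  exists N, forall n, (N <= n)%N ->
  exists z, [/\ Hn n z, nrm z = 1, nrm (z - x) < eta & nrm (Tn n z - T x) < eta].
Proof.
move=> Dx x1 eta0.
(* Rescaling by [t = 1 / nrm z], where [t <= 2] since [eps <= 1 / 2], costs [2 * eps * (1 + nrm b)]
   at the target [b]. The factor [B] covers both [b = x], of norm 1, and [b = T x]. *)
pose B := 4 * (1 + nrm (T x)).
have B0 : 0 < B by rewrite mulr_gt0 // ltr_wpDr ?nrm_ge0.
pose eps := Num.min 2^-1 (eta / B).
have eps0 : 0 < eps by rewrite lt_min invr_gt0 ltr0n divr_gt0.
have epsB : eps * B <= eta by rewrite -ler_pdivlMr // ge_min lexx orbT.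
have eps2 : eps <= 2^-1 by rewrite ge_min lexx.
have [N hN] := gsr_approx Dx eps0; exists N => n /hN[z [Hz h1 h2]].
set s := nrm z.
have s1 : `|1 - s| <= eps.
  rewrite ler_norml; have := nrm_le_dist hip z x; have := nrm_le_dist hip x z.
  by rewrite (nrmBC hip x) x1 -/s; lra.
have [s_lo s_hi] : 1 - eps <= s /\ s <= 1 + eps by move: s1; rewrite ler_norml; lra.
have s0 : 0 < s by lra.
have z0 : z != 0 by apply: contraTneq s0 => z0; rewrite /s z0 nrm0 // ltxx.
pose t := s^-1; have t0 : 0 < t by rewrite invr_gt0.
have ts : t * s = 1 by rewrite mulVf // gt_eqF.
have t2 : t <= 2 by nra.
have [AV AL] := shifted_compression_linear n 0.
have HZ (a : R[i]) v : Hn n v -> Hn n (a *: v).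
  by move=> Hv; have [d [e Ve]] := onbasis_exists hip (hHn n); exact: (V_scale Ve).
have TnZ (a : R[i]) v : Hn n v -> Tn n (a *: v) = a *: Tn n v.
  move=> Hv; have [d [e Ve]] := onbasis_exists hip (hHn n).
  have A0 := linear_on0 Ve (shifted_compression_linear n 0).
  have := AL a v 0 Hv (V_0 Ve); rewrite A0 !addr0 !scale0r !subr0.
  by [].
have split_scale (a b : H) : t%:C *: a - b = t%:C *: (a - b) + (t - 1)%:C *: b.
  by rewrite scalerBr rmorphB scalerBl rmorph1 scale1r addrA subrK.
have ct : cmod t%:C = t by rewrite cmod_real // ltW.
have ct1 : cmod (t - 1)%:C <= 2 * eps.
  have -> : cmod (t - 1)%:C = `|t - 1|.
    by rewrite /cmod normc_def /= expr0n addr0 sqrtr_sqr.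
  have -> : t - 1 = t * (1 - s) by rewrite mulrBr mulr1 ts.
  by rewrite normrM gtr0_norm // ler_pM // ltW.
have est (a b : H) : nrm (a - b) < eps -> nrm (t%:C *: a - b) < 2 * eps * (1 + nrm b).
  move=> hab; rewrite split_scale; apply: le_lt_trans (nrmD hip _ _) _.
  rewrite !(nrmZ hip) ct mulrDr mulr1; apply: ltr_leD.
    by apply: le_lt_trans (_ : 2 * nrm (a - b) < _); rewrite ?ler_wpM2r ?nrm_ge0 ?ltr_pM2l.
  by rewrite ler_wpM2r ?nrm_ge0.
have bT := nrm_ge0 hip (T x).
exists (t%:C *: z); split.
- exact: HZ.
- by rewrite (nrmZ hip) ct.
- by apply: lt_le_trans (est _ _ h1) _; rewrite x1; rewrite /B in epsB; nra.
- rewrite TnZ //; apply: lt_le_trans (est _ _ h2) _.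
  by rewrite /B in epsB; nra.
Qed.

(** The last clause is the dual form of [nrm ((Tn - mu)^* w) <= tau], the adjoint being taken in
    [Hn n]. *)
Definition near_null n (mu : R[i]) (tau : R) w : Prop :=
  [/\ Hn n w, nrm w = 1
    & forall v, Hn n v -> cmod (ip (Tn n v - mu *: v) w) <= tau * nrm v].

Lemma near_nullW n mu tau tau' w : tau <= tau' -> near_null n mu tau w -> near_null n mu tau' w.
Proof.
move=> le [Hw w1 hw]; split=> // v Hv; apply: le_trans (hw v Hv) _.
by rewrite ler_wpM2r ?nrm_ge0.
Qed.

(* [f = (T - mu0) x] is close to [(Tn - mu) z], which is almost orthogonal to [w]. *)
Lemma near_null_weak mu0 f (eta : R) : rho mu0 -> 0 < eta ->
  exists2 tau : R, 0 < tau & exists N, forall n, (N <= n)%N ->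
  forall mu, cmod (mu - mu0) < tau -> forall w, near_null n mu tau w -> cmod (ip w f) < eta.
Proof.
move=> [surj _] eta0; have [x [Dx [hx _]]] := surj f I.
(* [B] bounds [nrm z]. The terms [eps * c], [tau * B] (from [mu - mu0]) and [tau * B] (from
   [near_null]) are each at most [eta / 4]. *)
pose B := nrm x + 1; have B0 : 0 < B by rewrite ltr_wpDl ?nrm_ge0.
pose c := 1 + cmod mu0; have c0 : 0 < c by rewrite ltr_wpDr ?cmod_ge0.
pose tau := eta / (4 * B); have B40 : 0 < 4 * B by rewrite mulr_gt0.
have tau0 : 0 < tau by rewrite divr_gt0.
have tauB : tau * (4 * B) = eta by rewrite divfK // gt_eqF.
pose eps := Num.min 1 (eta / (4 * c)); have c40 : 0 < 4 * c by rewrite mulr_gt0.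
have eps0 : 0 < eps by rewrite lt_min ltr01 divr_gt0.
have epsc : eps * (4 * c) <= eta by rewrite -ler_pdivlMr // ge_min lexx orbT.
have eps1 : eps <= 1 by rewrite ge_min lexx.
exists tau => //; have [N hN] := gsr_approx Dx eps0; exists N => n /hN[z [Hz h1 h2]].
move=> mu hmu w [Hw w1 hw].
have zB : nrm z <= B by have := nrm_le_dist hip z x; rewrite /B; lra.
have hwz := hw z Hz.
have -> : cmod (ip w f) = cmod (ip f w) by rewrite (ip_conj hip) cmod_conj.
pose g := Tn n z - mu *: z.
have fg : f - g = (T x - Tn n z) + mu0 *: (z - x) + (mu - mu0) *: z.
  rewrite /g -hx scalerBr scalerBl subrACA -[RHS]addrA; congr (_ + _).
  by rewrite opprB [RHS]addrC addrA subrK.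
have nfg : nrm (f - g) <= eps + cmod mu0 * eps + tau * B.
  rewrite fg; apply: le_trans (nrmD hip _ _) _; apply: lerD.
    apply: le_trans (nrmD hip _ _) _; rewrite (nrmBC hip) (nrmZ hip).
    by apply: lerD; rewrite ?ler_wpM2l ?cmod_ge0 // ltW.
  by rewrite (nrmZ hip); apply: ler_pM; rewrite ?cmod_ge0 ?nrm_ge0 // ltW.
have := cs_le hip nfg (lexx (nrm w)); rewrite w1 mulr1 => h3.
have := cmodD (ip (f - g) w) (ip g w); rewrite -(ipDl hip) subrK => h4.
have h5 : tau * nrm z <= tau * B by rewrite ler_wpM2l // ltW.
rewrite /c in epsc; rewrite -/g in hwz; nra.
Qed.

Lemma near_null_weak_seq mu0 (F : seq H) (eta : R) : rho mu0 -> 0 < eta ->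
  exists2 tau : R, 0 < tau & exists N, forall n, (N <= n)%N ->
  forall mu, cmod (mu - mu0) < tau -> forall w, near_null n mu tau w ->
  forall f, f \in F -> cmod (ip w f) < eta.
Proof.
move=> r0 eta0; elim: F => [|f F [tau tau0 [N hN]]]; first by exists 1 => //; exists 0%N.
have [tau' tau'0 [N' hN']] := near_null_weak f r0 eta0.
exists (Num.min tau tau'); first by rewrite lt_min tau0.
exists (maxn N N') => n; rewrite geq_max => /andP[Nn N'n] mu.
rewrite lt_min => /andP[h h'] w hw g; rewrite in_cons => /orP[/eqP ->|].
  by apply: (hN' n N'n mu h' w); apply: near_nullW hw; rewrite ge_min lexx orbT.
by apply: (hN n Nn mu h w); apply: near_nullW hw; rewrite ge_min lexx.
Qed.

(** A near-null [w] is almost orthogonal to any finite [F], and the choice [v = w] puts [ip (T w) w]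
    near [mu]; so it would be a witness for [finitary_ess] at [mu0]. *)
Lemma no_near_null mu0 : rho mu0 -> ~ finitary_ess ip D T mu0 ->
  exists2 tau : R, 0 < tau & exists N, forall n, (N <= n)%N ->
  forall mu, cmod (mu - mu0) < tau -> forall w, ~ near_null n mu tau w.
Proof.
move=> r0 /existsNP[F /existsNP[eta /not_implyP[eta0 no]]].
have [tau tau0 [N hN]] := near_null_weak_seq F r0 eta0.
have e2 : 0 < eta / 2 by rewrite divr_gt0.
exists (Num.min tau (eta / 2)); first by rewrite lt_min tau0.
exists N => n Nn mu; rewrite lt_min => /andP[h h'] w hw.
have [Hw w1 hnull] := hw.
apply: no; exists w; split=> //; first exact: hHnD Hw.
  by apply: (hN n Nn mu h w); apply: near_nullW hw; rewrite ge_min lexx.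
have := hnull w Hw; rewrite w1 mulr1 le_min => /andP[_].
rewrite (ipBl hip) (ip_compression _ Hw) (ipZl hip) -(nrm_sqr hip) w1 expr1n mulr1 => h2.
by have := cmodD (ip (T w) w - mu) (mu - mu0); rewrite addrA subrK; lra.
Qed.

(** In finite dimension a spectral point has zero determinant, which yields an exact kernel vector
    of the adjoint; hence even [tau = 0] is allowed. *)
Lemma compression_spectrum_null n mu : spectrum ip (Hn n) (Hn n) (Tn n) mu ->
  forall tau : R, 0 <= tau -> exists w, near_null n mu tau w.
Proof.
move=> sp tau tau0; have [d [e Ve]] := onbasis_exists hip (hHn n).
have lin := shifted_compression_linear n mu.
have [dz|dz] := eqVneq (\det (opmx ip e (fun v => Tn n v - mu *: v))) 0.
  have [w [Hw w1 hw]] := singular_annihilator hip Ve lin dz.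
  by exists w; split=> // v Hv; rewrite hw // cmod0 mulr_ge0 ?nrm_ge0.
have [surj [M M0 hM]] := regular_bound hip Ve lin dz.
case: sp; split; last by exists M%:C => x Hx; apply: vnorm_le => //; exact: hM.
move=> y Hy; have [x [Hx hx]] := surj y Hy; exists x; split=> //; split=> // x' Hx' hx'.
have Hd : Hn n (x' - x) by rewrite addrC -scaleN1r; exact: Hn_linear.
apply/eqP; rewrite -subr_eq0; apply/eqP/(nrm_eq0 hip)/eqP.
rewrite eq_le nrm_ge0 // andbT; apply: le_trans (hM _ Hd) _.
have -> : x' - x = -1 *: x + x' by rewrite scaleN1r addrC.
have [_ ->] // := lin; rewrite hx hx' scaleN1r addNr.
by rewrite nrm0 // mulr0.
Qed.

(** An inverse and its adjoint have the same norm: a vector [u] violating the bound is converted by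
    [adjoint_small] into a near-null [w]. *)
Lemma compression_resolvent_bound n mu (tau : R) : 0 < tau ->
  resolvent ip (Hn n) (Hn n) (Tn n) mu -> (forall w, ~ near_null n mu tau w) ->
  forall u, Hn n u -> nrm u <= tau^-1 * nrm (Tn n u - mu *: u).
Proof.
move=> tau0 [surj _] no u Hu; rewrite leNgt; apply/negP.
rewrite ltr_pdivrMl // => h.
have [d [e Ve]] := onbasis_exists hip (hHn n).
have onto y : Hn n y -> exists x, Hn n x /\ Tn n x - mu *: x = y.
  by move=> Hy; have [x [Hx [hx _]]] := surj y Hy; exists x.
have inj x y : Hn n x -> Hn n y -> Tn n x - mu *: x = Tn n y - mu *: y -> x = y.
  move=> Hx Hy hxy; have [AV _] := shifted_compression_linear n mu.
  have [z [_ [_ uniq]]] := surj _ (AV x Hx).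
  by rewrite (uniq x) // (uniq y).
have [w [Hw w1 hw]] := adjoint_small hip Ve (shifted_compression_linear n mu) onto inj Hu h.
by apply: (no w); split.
Qed.

Lemma ess_seq_sub lam : ess_num_range_seq ip Hn Tn lam -> finitary_ess ip D T lam.
Proof.
move=> [I [x [Iinf [hx [wx /ccvg_alongP lx]]]]] F eta eta0.
have [N hN] := weak_to0_finite F wx eta0; have [N' hN'] := lx _ eta0.
have [n [le In]] := Iinf (maxn N N'); move: le; rewrite geq_max => /andP[Nn N'n].
have [Hx x1] := hx n In; exists (x n); split.
- exact: hHnD Hx.
- exact/(vnorm1 hip).
- exact: hN.
- by have := hN' n In N'n; rewrite (ip_compression _ Hx).
Qed.

Lemma ess_sub_seq lam : separable_space ip ->
  finitary_ess ip D T lam -> ess_num_range_seq ip Hn Tn lam.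
Proof.
move=> [d hd] ess.
pose G k n z := [/\ Hn n z, nrm z = 1,
  forall j, (j <= k)%N -> cmod (ip z (d j)) < k.+1%:R^-1
  & cmod (ip (Tn n z) z - lam) < k.+1%:R^-1].
have inv_le (k l : nat) : (k <= l)%N -> l.+1%:R^-1 <= k.+1%:R^-1 :> R.
  by move=> kl; rewrite lef_pV2 ?posrE ?ltr0n // ler_nat ltnS.
have mono k l n z : (k <= l)%N -> G l n z -> G k n z.
  move=> kl [Hz z1 h1 h2]; split=> // [j jk|]; last exact: lt_le_trans h2 (inv_le _ _ kl).
  by apply: lt_le_trans (h1 j _) (inv_le _ _ kl); exact: leq_trans kl.
have ex k : exists n z, (k <= n)%N /\ G k n z.
  set eta : R := k.+1%:R^-1; have eta0 : 0 < eta by rewrite invr_gt0 ltr0n.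
  have eta2 : 0 < eta / 2 by rewrite divr_gt0.
  have [x [Dx x1 hF hx]] := ess [seq d j | j <- iota 0 k.+1] _ eta2.
  pose S := \sum_(j < k.+1) nrm (d j).
  (* [B] dominates each [nrm (d j)] with [j <= k] as well as [1 + nrm (T x)], so an approximation
     within [eta / (2 * B)] changes every pairing by at most [eta / 2]. *)
  pose B := S + nrm (T x) + 1.
  have S0 : 0 <= S by apply: sumr_ge0 => j _; exact: nrm_ge0.
  have T0 := nrm_ge0 hip (T x).
  have B0 : 0 < 2 * B by rewrite /B; lra.
  have [N hN] := gsr_approx_unit Dx x1 (divr_gt0 eta0 B0).
  have [z [Hz z1 h1 h2]] := hN (maxn k N) (leq_maxr _ _).
  exists (maxn k N), z; split; first exact: leq_maxl.
  rewrite ltr_pdivlMr // in h1; rewrite ltr_pdivlMr // in h2.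
  have p1 := nrm_ge0 hip (z - x); have p2 := nrm_ge0 hip (Tn (maxn k N) z - T x).
  split=> // [j jk|].
    have dS : nrm (d j) <= S.
      rewrite /S (bigD1 (Ordinal (jk : (j < k.+1)%N))) //= lerDl.
      by apply: sumr_ge0 => i _; exact: nrm_ge0.
    have hd0 := nrm_ge0 hip (d j).
    have := cmodD (ip (z - x) (d j)) (ip x (d j)); rewrite -(ipDl hip) subrK.
    have := cauchy_schwarz hip (z - x) (d j).
    have : cmod (ip x (d j)) < eta / 2.
      by apply: hF; apply/mapP; exists j => //; rewrite mem_iota /= add0n ltnS.
    have : nrm (z - x) * nrm (d j) <= nrm (z - x) * B.
      by rewrite ler_wpM2l // /B; lra.
    by rewrite -/eta; lra.
  have e1 : ip (Tn (maxn k N) z) z - lam =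
      ip (Tn (maxn k N) z - T x) z + ip (T x) (z - x) + (ip (T x) x - lam).
    by rewrite (ipBl hip) (ipBr hip) !addrA !subrK.
  rewrite e1; apply: le_lt_trans (cmodD _ _) _.
  have := cmodD (ip (Tn (maxn k N) z - T x) z) (ip (T x) (z - x)).
  have := cauchy_schwarz hip (Tn (maxn k N) z - T x) z; rewrite z1 mulr1.
  have := cauchy_schwarz hip (T x) (z - x).
  rewrite -/eta; move: h1 h2; rewrite /B; nra.
have [I [x [Iinf hx]]] := diagonal_extraction mono ex.
have [N0 hN0] := hx 0%N.
(* Membership in [Hn n] and unit norm are only guaranteed from [N0] on, so the earlier indices are
   removed from [I]. *)
exists (fun n => I n /\ (N0 <= n)%N), x; split; last split; last split.
- move=> N; have [n [le In]] := Iinf (maxn N N0); exists n.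
  by move: le; rewrite geq_max => /andP[].
- by move=> n [In le]; have [Hz z1 _ _] := hN0 n In le; split=> //; exact/(vnorm1 hip).
- apply: (weak_to0_dense hip hd) => [n [In le]|k]; first by case: (hN0 n In le).
  by have [N hN] := hx k; exists N => n [In _] le; case: (hN n In le).
- apply/ccvg_alongP => e /archi_inv[k hk]; have [N hN] := hx k.
  by exists N => n [In _] /(hN n In)[_ _ _ h]; exact: lt_trans hk.
Qed.

Lemma pollution_ess lam :
  spectral_pollution ip Hn Hn Tn D T lam -> finitary_ess ip D T lam.
Proof.
move=> [/contrapT r0 [I [l [Iinf [sp /ccvg_alongP ll]]]]].
apply: contrapT => no; have [tau tau0 [N hN]] := no_near_null r0 no.
have [N' hN'] := ll _ tau0.
have [n [le In]] := Iinf (maxn N N'); move: le; rewrite geq_max => /andP[Nn N'n].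
have [w hw] := compression_spectrum_null (sp n In) (ltW tau0).
exact: hN n Nn (l n) (hN' n In N'n) w hw.
Qed.

Lemma isolated_approximated lam : complete_space ip ->
  spectrum ip (fun=> True) D T lam ->
  (exists r : R[i], 0 < r /\ forall mu, spectrum ip (fun=> True) D T mu ->
                      `|mu - lam| < r -> mu = lam) ->
  ~ finitary_ess ip D T lam ->
  exists (I : nat -> Prop) (l : nat -> R[i]), infinite_nat I /\
    (forall n, I n -> spectrum ip (Hn n) (Hn n) (Tn n) (l n)) /\ ccvg_along I l lam.
Proof.
move=> comp sp [_ [/complex_gt0E[r r0 ->] iso]] no.
apply: contrapT => nappr; apply: sp.
have regular mu : mu != lam -> cmod (mu - lam) < r -> rho mu.
  move=> ne h; apply: contrapT => hs; case/eqP: ne; apply: iso => //.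
  by rewrite cmodE ltcR.
have [r1 r10 ess_far] := finitary_ess_open no.
have [k0 gap] : exists k, forall n, (k <= n)%N -> forall mu,
    cmod (mu - lam) < k.+1%:R^-1 -> resolvent ip (Hn n) (Hn n) (Tn n) mu.
  apply: contrapT => hn; apply: nappr.
  pose G k n mu := spectrum ip (Hn n) (Hn n) (Tn n) mu /\ cmod (mu - lam) < k.+1%:R^-1.
  have [||I [l [Iinf hl]]] := @diagonal_extraction _ G.
  - move=> k m n mu km [h1 h2]; split=> //; apply: lt_le_trans h2 _.
    by rewrite lef_pV2 ?posrE ?ltr0n // ler_nat ltnS.
  - move=> k; move/forallNP/(_ k)/existsNP: hn => [n].
    move=> /not_implyP[kn /existsNP[mu /not_implyP[h1 h2]]].
    by exists n, mu.
  have [N0 hN0] := hl 0%N.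
  exists (fun n => I n /\ (N0 <= n)%N), l; split; last split.
  - move=> N; have [n [le In]] := Iinf (maxn N N0); exists n.
    by move: le; rewrite geq_max => /andP[].
  - by move=> n [In le]; case: (hN0 n In le).
  - apply/ccvg_alongP => e /archi_inv[k hk]; have [N hN] := hl k.
    by exists N => n [In _] /(hN n In)[_ h]; exact: lt_trans hk.
pose eps := Num.min r (Num.min r1 k0.+1%:R^-1).
have eps0 : 0 < eps by rewrite !lt_min r0 r10 invr_gt0 ltr0n.
have epsP (z : R) : z < eps -> [/\ z < r, z < r1 & z < k0.+1%:R^-1].
  by rewrite !lt_min => /and3P.
(* The square of half-side [a] has points of modulus at most [2 * a < eps], so it stays within all
   three radii. *)
pose a := eps / 3; have a0 : 0 < a by rewrite divr_gt0.
have a_eps : a + a < eps by rewrite /a; lra.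
(* The clause [a <= cmod nu] keeps away from the spectral point [lam] but retains the circle of
   radius [a]. *)
have [k1 unif] : exists k, forall nu, `|complex.Re nu| <= a -> `|complex.Im nu| <= a ->
    a <= cmod nu -> forall n, (k <= n)%N ->
    forall w, ~ near_null n (lam + nu) k.+1%:R^-1 w.
  apply: (@square_uniform _ a (fun k nu => a <= cmod nu -> forall n, (k <= n)%N ->
    forall w, ~ near_null n (lam + nu) k.+1%:R^-1 w)) => [k l nu kl h an n ln w hw|nu0 hre him].
    apply: (h an n (leq_trans kl ln) w); apply: near_nullW hw.
    by rewrite lef_pV2 ?posrE ?ltr0n // ler_nat ltnS.
  (* Inside the open disc a small ball never meets the clause, so the property is vacuous there. *)
  have [in_disc|out] := ltP (cmod nu0) a.
    exists (a - cmod nu0); first by rewrite subr_gt0.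
    exists 0%N => nu hnu an; have := cmodD (nu - nu0) nu0; rewrite subrK; lra.
  have nu0_eps : cmod (lam + nu0 - lam) < eps.
    rewrite addrAC subrr add0r; apply: le_lt_trans (cmod_le_ReIm _) _.
    exact: le_lt_trans (lerD hre him) a_eps.
  have [b1 b2 _] := epsP _ nu0_eps.
  have ne : lam + nu0 != lam.
    rewrite -subr_eq0 addrAC subrr add0r; apply: contraTneq out => ->.
    by rewrite cmod0 -ltNge.
  have [tau tau0 [N hN]] := no_near_null (regular _ ne b1) (ess_far _ b2).
  have [k hk] := archi_inv tau0.
  exists tau => //; exists (maxn N k) => nu hnu an n; rewrite geq_max => /andP[Nn kn] w hw.
  apply: (hN n Nn (lam + nu) _ w).
    by rewrite opprD addrACA subrr add0r.
  apply: near_nullW hw; apply: le_trans (ltW hk).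
  by rewrite lef_pV2 ?posrE ?ltr0n // ler_nat ltnS leq_maxr.
pose M0 : R := k1.+1%:R; have M0p : 0 < M0 by rewrite ltr0n.
have low_n n : (maxn k0 k1 <= n)%N ->
    forall u, Hn n u -> nrm u <= M0 * nrm (Tn n u - lam *: u).
  rewrite geq_max => /andP[k0n k1n].
  have shift mu u : Tn n u - lam *: u - mu *: u = Tn n u - (lam + mu) *: u.
    by rewrite scalerDl opprD addrA.
  have near mu : cmod mu < eps -> resolvent ip (Hn n) (Hn n) (Tn n) (lam + mu).
    move=> /epsP[_ _ h]; apply: gap => //.
    by rewrite addrAC subrr add0r.
  apply: (resolvent_maximum_principle hip (hHn n) (shifted_compression_linear n lam)
    _ (ltW M0p) (eps := eps) (a := a)).
  - by rewrite a0 /=; lra.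
  - move=> mu /near[surj [M hM]]; split=> [y Hy|].
      have [x [Hx [hx uniq]]] := surj y Hy; exists x; rewrite shift; split=> //; split=> // x' Hx'.
      by rewrite shift; exact: uniq.
    by exists M => x Hx; rewrite shift; exact: hM.
  - move=> mu hmu u Hu; rewrite shift -[M0]invrK.
    apply: compression_resolvent_bound => //; first by rewrite invr_gt0.
      by apply: near; rewrite hmu; lra.
    move=> w; apply: unif; rewrite ?hmu //.
    + by rewrite -hmu; exact: Re_le_cmod.
    + by rewrite -hmu; exact: Im_le_cmod.
have low x : D x -> nrm x <= M0 * nrm (T x - lam *: x).
  move=> Dx; apply/ler_addgt0Pr => eta eta0.
  (* With errors below [q = eta / c], replacing [x] by [z] costs [q] on the left and
     [M0 * (1 + cmod lam) * q] on the right, in total [eta]. *)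
  pose c := 1 + M0 * (1 + cmod lam).
  have cl := cmod_ge0 lam.
  have c0 : 0 < c by rewrite /c; nra.
  have [N hN] := gsr_approx Dx (divr_gt0 eta0 c0).
  have [z [Hz h1 h2]] := hN _ (leq_maxr (maxn k0 k1) N).
  have h3 := low_n _ (leq_maxl (maxn k0 k1) N) z Hz.
  have e1 : Tn (maxn (maxn k0 k1) N) z - lam *: z =
    (T x - lam *: x) + ((Tn (maxn (maxn k0 k1) N) z - T x) - lam *: (z - x)).
    by rewrite scalerBr subrACA [RHS]addrC subrK.
  have := nrmD hip (T x - lam *: x) ((Tn (maxn (maxn k0 k1) N) z - T x) - lam *: (z - x)).
  rewrite -e1 => h4.
  have := nrmB hip (Tn (maxn (maxn k0 k1) N) z - T x) (lam *: (z - x)).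
  rewrite (nrmZ hip) => h5.
  have h6 := nrm_le_dist hip x z; rewrite (nrmBC hip) in h6.
  set q := eta / c in h1 h2.
  have qc : q * c = eta by rewrite divfK // gt_eqF.
  have h7 : cmod lam * nrm (z - x) <= cmod lam * q by rewrite ler_wpM2l // ltW.
  have h8 : M0 * nrm (Tn (maxn (maxn k0 k1) N) z - lam *: z) <=
     M0 * (nrm (T x - lam *: x) + (q + cmod lam * q)).
    by rewrite ler_wpM2l ?(ltW M0p) //; lra.
  rewrite -qc /c; move: h8; rewrite !mulrDr mulr1; nra.
(* The point [lam + t] lies in the punctured disc contained in [rho(T)], and [t <= 1 / (4 * M0)] is
   the closeness that [resolvent_neumann] asks for. *)
pose t := Num.min (eps / 2) (4 * M0)^-1.
have t0 : 0 < t by rewrite lt_min divr_gt0 // invr_gt0 mulr_gt0.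
have ct : cmod (lam + t%:C - lam) = t by rewrite addrAC subrr add0r cmod_real // ltW.
have [b1 _ _] : [/\ t < r, t < r1 & t < k0.+1%:R^-1].
  apply: epsP; apply: le_lt_trans (_ : eps / 2 < _); first by rewrite ge_min lexx.
  by lra.
have rmu : rho (lam + t%:C).
  apply: regular; last by rewrite ct.
  by apply/eqP => h; move: ct; rewrite h subrr cmod0 => h0; rewrite -h0 ltxx in t0.
apply: (resolvent_neumann hip comp hT rmu M0p low); rewrite ct.
apply: le_trans (_ : M0 * (4 * M0)^-1 <= _).
  by rewrite ler_wpM2l ?(ltW M0p) // ge_min lexx orbT.
by rewrite invfM mulrCA mulfV ?mulr1 // gt_eqF.
Qed.

End Galerkin.

Unset Implicit Arguments.

Theorem theorem6p1 (R : realType) (H : lmodType R[i]) (ip : H -> H -> R[i])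
  (hH : separable_inf_dim_hilbert ip)
  (D : H -> Prop) (T : H -> H)
  (hT : linear_operator D T) (hdense : dense ip D)
  (Hn : nat -> H -> Prop) (P : nat -> H -> H)
  (hHn : forall n, fin_dim_subspace (Hn n))
  (hHnD : forall n x, Hn n x -> D x)
  (hP : forall n, orth_proj ip (Hn n) (P n))
  (hPs : forall x, cvg_to ip (fun n => P n x) x)
  (hgsr : gsr_convergence ip Hn Hn P (fun n => compression (P n) T) D T) :
  [/\ forall lam, ess_num_range_seq ip Hn (fun n => compression (P n) T) lam
                  <-> ess_num_range ip D T lam,
      forall lam, spectral_pollution ip Hn Hn (fun n => compression (P n) T) D T lam
                  -> ess_num_range ip D T lam
    & forall lam,
        spectrum ip (fun _ => True) D T lam ->
        (exists r : R[i], 0 < r /\ forall mu, spectrum ip (fun _ => True) D T mu ->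
                              `|mu - lam| < r -> mu = lam) ->
        ~ ess_num_range ip D T lam ->
        exists (I : nat -> Prop) (l : nat -> R[i]), infinite_nat I /\
          (forall n, I n -> spectrum ip (Hn n) (Hn n) (compression (P n) T) (l n)) /\
          ccvg_along I l lam].
Proof.
have [hip comp sep _] := hH.
have ess lam := ess_num_range_finitary hip D T lam sep.
split=> lam.
- split=> [/(ess_seq_sub hip hHnD hP)|/ess]; first by move/ess.
  exact: (ess_sub_seq hip hT hHn hHnD hP hPs hgsr sep).
- by move/(pollution_ess hip hT hHn hHnD hP hPs hgsr)/ess.
- move=> sp iso no.
  apply: (isolated_approximated hip hT hHn hHnD hP hPs hgsr comp sp iso).
  by move/ess.
Qed.
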